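(* Let $p$ be a prime, $k$ an algebraically closed field of characteristic $p$, and $G=\mathrm{SL}_2(\mathbb{F}_p)$. Suppose $1\le m\le n\le p$. Then there is an isomorphism of $kG$-modules $$V_n\otimes V_m\;\cong\;\bigoplus_{\substack{i\in\langle n,m\rangle\cap[p]\\ 2p-i\notin\langle n,m\rangle}}V_i\;\oplus\;\bigoplus_{\substack{i\in\langle n,m\rangle\cap[p]\\ 2p-i\in\langle n,m\rangle}}P_i\;\oplus\;[n=m=p]\,V_p .$$
   Context: For $n\ge1$, $V_n$ is the $n$-dimensional $kG$-module of homogeneous polynomials over $k$ of degree $n-1$ in two variables $X,Y$, where $\begin{pmatrix}a&b\\c&d\end{pmatrix}\in G$ acts by $f(X,Y)\mapsto f(aX+cY,\,bX+dY)$. The modules $V_1,\dots,V_p$ form a complete set of simple $kG$-modules up to isomorphism. For $1\le n\le p$, $P_n$ is the projective cover of $V_n$ as a $kG$-module. Tensor products are over $k$ with diagonal $G$-action. $[r]=\{1,2,\dots,r\}$. For $n\ge m\ge1$, $\langle n,m\rangle=\{n+m-1,\,n+m-3,\,\dots,\,n-m+3,\,n-m+1\}$ (a set with $m$ elements). $[n=m=p]$ is an Iverson bracket: the summand $[n=m=p]V_p$ equals $V_p$ if $n=m=p$ and is $0$ otherwise. *)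

(* Defs.v *)
From HB Require Import structures.
From mathcomp Require Import all_boot all_order all_algebra.
From mathcomp Require Import all_fingroup all_solvable all_field all_character.
From mathcomp Require Import mpoly.

Set Implicit Arguments.
Unset Strict Implicit.
Unset Printing Implicit Defensive.

Import GRing.Theory.
Local Open Scope ring_scope.

Section SL2.
Variable p : nat.

Definition SL2 : {set {'GL_2(p)}} := [set g : {'GL_2(p)} | \det (GLval g) == 1].

Lemma SL2_group_set : group_set SL2.
Proof.
apply/group_setP; split=> [|x y]; first by rewrite inE GL_1E det1.
by rewrite !inE GL_ME det_mulmx => /eqP-> /eqP->; rewrite mulr1.
Qed.

Canonical SL2_group := Group SL2_group_set.

End SL2.

(* A finite-dimensional left kG-module is given by a matrix representation     *)
(* acting on COLUMN vectors, g . v = rG g *m v. MathComp's submodule theory    *)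
(* acts on row vectors instead; mx_rsim, prod_repr and dadd_grepr mean the     *)
(* same for both readings, but the notions of this section do not.             *)
Section LeftModules.
Variables (k : fieldType) (gT : finGroupType) (G : {group gT}).

Definition is_hom (M N : representation k G)
    (f : 'M[k]_(rdegree N, rdegree M)) : Prop :=
  {in G, forall g, f *m M g = N g *m f}.

(* Being onto as a map v |-> f *m v of column vectors is having full row rank. *)
Definition is_epi (M N : representation k G)
    (f : 'M[k]_(rdegree N, rdegree M)) : Prop :=
  is_hom f /\ row_free f.

Definition projective (P : representation k G) : Prop :=
  forall (M N : representation k G)
         (e : 'M[k]_(rdegree N, rdegree M)) (f : 'M[k]_(rdegree N, rdegree P)),
    is_epi e -> is_hom f ->
  exists2 h : 'M[k]_(rdegree M, rdegree P), is_hom h & e *m h = f.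

Definition essential_epi (P V : representation k G)
    (e : 'M[k]_(rdegree V, rdegree P)) : Prop :=
  is_epi e /\
  forall (M : representation k G) (h : 'M[k]_(rdegree P, rdegree M)),
    is_hom h -> is_epi (e *m h) -> is_epi h.

Definition projective_cover (P V : representation k G) : Prop :=
  projective P /\
  exists e : 'M[k]_(rdegree V, rdegree P), essential_epi e.

End LeftModules.

Section SimpleModules.
Variables (k : fieldType) (p : nat).
Hypothesis charkp : p \in [pchar k].

Definition Fp_embed (x : 'F_p) : k := (x : nat)%:R.

(* With X = 'X_0 and Y = 'X_1, f(X, Y) |-> f(aX + cY, bX + dY) for the matrix  *)
(* g with rows (a, b) and (c, d): variable j is replaced by column j of g.     *)
Definition subst_form (g : {'GL_2(p)}) (j : 'I_2) : {mpoly k[2]} :=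
  \sum_(i < 2) Fp_embed (g i j) *: 'X_i.

Definition act_poly (g : {'GL_2(p)}) (f : {mpoly k[2]}) : {mpoly k[2]} :=
  f \mPo [tuple subst_form g j | j < 2].

(* The monomials X^(n-1-i) Y^i, i < n, form a basis of V_n. *)
Definition monom (n i : nat) : 'X_{1..2} :=
  [multinom if j == ord0 then (n.-1 - i)%N else i | j < 2].

(* Column j holds the coordinates of g . X^(n-1-j) Y^j. *)
Definition V_mx (n : nat) (g : {'GL_2(p)}) : 'M[k]_n :=
  \matrix_(i < n, j < n) (act_poly g 'X_[monom n j])@_(monom n i).

Definition poly_of_cV (n : nat) (v : 'cV[k]_n) : {mpoly k[2]} :=
  \sum_(i < n) v i 0 *: 'X_[monom n i].

Lemma mdeg_monom n i : (i < n)%N -> mdeg (monom n i) = n.-1.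
Proof.
move=> lt_in; rewrite mdegE !big_ord_recl big_ord0 !mnmE /= addn0 subnK //.
by case: n lt_in.
Qed.

Lemma monom_inj n (i j : 'I_n) : monom n i = monom n j -> i = j.
Proof.
move=> /(congr1 (fun m : 'X_{1..2} => m (lift ord0 ord0))).
by rewrite !mnmE /= => /val_inj.
Qed.

Lemma mdeg_is_monom n (m : 'X_{1..2}) :
  (0 < n)%N -> mdeg m = n.-1 -> exists i : 'I_n, m = monom n i.
Proof.
move=> n_gt0; rewrite mdegE !big_ord_recl big_ord0 addn0 => dm.
have lt_in : (m (lift ord0 ord0) < n)%N.
  by rewrite -(prednK n_gt0) ltnS -dm leq_addl.
exists (Ordinal lt_in); apply/mnmP=> j; rewrite mnmE /= -dm addnK.
by case: (unliftP 0 j) => [j' ->|->] //=; congr (m (lift _ _)); rewrite [j']ord1.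
Qed.

Lemma mcoeff_poly_of_cV n (v : 'cV[k]_n) (i : 'I_n) :
  (poly_of_cV v)@_(monom n i) = v i 0.
Proof.
rewrite raddf_sum /= (bigD1 i) //= big1 => [|j neq_ji].
  by rewrite mcoeffZ mcoeffX eqxx mulr1 addr0.
rewrite mcoeffZ mcoeffX; case: eqP => [/monom_inj ji|]; last by rewrite mulr0.
by rewrite ji eqxx in neq_ji.
Qed.

Lemma poly_of_cV_homog n (v : 'cV[k]_n) : poly_of_cV v \is n.-1.-homog.
Proof.
apply: rpred_sum => i _; apply: rpredZ.
by rewrite dhomogX /= mdeg_monom.
Qed.

Lemma poly_of_cVK n (f : {mpoly k[2]}) : (0 < n)%N -> f \is n.-1.-homog ->
  poly_of_cV (\col_(i < n) f@_(monom n i)) = f.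
Proof.
move=> n_gt0 hf; apply/mpolyP=> m.
case: (eqVneq (mdeg m) n.-1) => [dm|ndm].
  have [i ->] := mdeg_is_monom n_gt0 dm.
  by rewrite mcoeff_poly_of_cV mxE.
by rewrite !(@dhomog_nemf_coeff _ _ mdeg n.-1) ?poly_of_cV_homog.
Qed.

Lemma act_poly_homog g d f : f \is d.-homog -> act_poly g f \is d.-homog.
Proof.
move=> hf; rewrite /act_poly comp_mpolyEX big_seq; apply: rpred_sum => m m_f.
have hl j : subst_form g j \is 1.-homog.
  by apply: rpred_sum => i _; apply: rpredZ; rewrite dhomogX /= mdeg1.
apply: rpredZ; rewrite comp_mpolyX -(dhomog_mf hf m_f) /=.
rewrite mdegE !big_ord_recl !big_ord0 !tnth_mktuple addn0 mulr1.
by apply: dhomogM; rewrite -[X in X.-homog]mul1n; apply: dhomogMn.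
Qed.

Lemma act_poly_cV n g (v : 'cV[k]_n) :
  act_poly g (poly_of_cV v) = poly_of_cV (V_mx n g *m v).
Proof.
case: n v => [|n] v.
  by rewrite /poly_of_cV !big_ord0 /act_poly raddf0.
rewrite -[LHS](@poly_of_cVK n.+1) ?act_poly_homog ?poly_of_cV_homog //.
congr poly_of_cV; apply/matrixP=> i j; rewrite !mxE (ord1 j).
rewrite /act_poly /poly_of_cV (raddf_sum (comp_mpoly _)) raddf_sum /=.
apply: eq_bigr => l _.
by rewrite mxE comp_mpolyZ mcoeffZ mulrC.
Qed.

Lemma poly_of_cV_inj n : injective (@poly_of_cV n).
Proof.
move=> u v uv; apply/matrixP=> i j; rewrite (ord1 j).
by rewrite -!mcoeff_poly_of_cV uv.
Qed.

Lemma Fp_embed_nat m : Fp_embed m%:R = m%:R.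
Proof.
have p_pr := pcharf_prime charkp.
rewrite /Fp_embed val_Fp_nat // [in RHS](divn_eq m p) natrD natrM.
by rewrite (pcharf0 charkp) mulr0 add0r.
Qed.

Lemma Fp_embedD x y : Fp_embed (x + y) = Fp_embed x + Fp_embed y.
Proof. by rewrite -[x]natr_Zp -[y]natr_Zp -natrD !Fp_embed_nat natrD. Qed.

Lemma Fp_embedM x y : Fp_embed (x * y) = Fp_embed x * Fp_embed y.
Proof. by rewrite -[x]natr_Zp -[y]natr_Zp -natrM !Fp_embed_nat natrM. Qed.

Lemma act_poly1 f : act_poly 1 f = f.
Proof.
rewrite /act_poly -[RHS]comp_mpoly_id; congr (_ \mPo _).
apply: eq_from_tnth => j; rewrite !tnth_mktuple /subst_form.
rewrite (bigD1 j) //= big1 ?addr0 => [|i /negPf nij].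
  by rewrite -idmxE mxE eqxx (Fp_embed_nat 1) scale1r.
by rewrite -idmxE mxE nij (Fp_embed_nat 0) scale0r.
Qed.

Lemma act_polyM g h f : act_poly (g * h)%g f = act_poly g (act_poly h f).
Proof.
elim/mpolyind: f => [|c m f _ _ IH]; first by rewrite /act_poly !raddf0.
have D u q r : act_poly u (q + r) = act_poly u q + act_poly u r.
  exact: comp_mpolyD.
rewrite !D IH; congr (_ + _).
rewrite /act_poly !comp_mpolyZ !comp_mpolyX; congr (_ *: _).
rewrite rmorph_prod; apply: eq_bigr => j _.
rewrite rmorphXn /= !tnth_mktuple; congr (_ ^+ _).
rewrite /subst_form (raddf_sum (comp_mpoly _)) /=.
under [RHS]eq_bigr => i _.
  rewrite comp_mpolyZ comp_mpolyXU -tnth_nth tnth_mktuple scaler_sumr.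
  over.
rewrite exchange_big; apply: eq_bigr => i _ /=.
rewrite -mulmxE mxE !big_ord_recl !big_ord0 !addr0 /=.
rewrite Fp_embedD !Fp_embedM scalerDl !scalerA.
by congr (_ *: _ + _ *: _); rewrite mulrC.
Qed.

Lemma V_mx_repr n : mx_repr (SL2 p) (V_mx n).
Proof.
have colP (A B : 'M[k]_n) : (forall v : 'cV_n, A *m v = B *m v) -> A = B.
  by move=> AB; apply/trmx_inj/row_matrixP=> i; rewrite -!tr_col !colE AB.
split=> [|g h _ _]; apply: colP => v; apply: poly_of_cV_inj.
  by rewrite -act_poly_cV act_poly1 mul1mx.
by rewrite -mulmxA -!act_poly_cV act_polyM.
Qed.

Definition V_repr (n : nat) : representation k (SL2_group p) :=
  Representation (MxRepresentation (V_mx_repr n)).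

End SimpleModules.

(* <n, m> = {n-m+1, n-m+3, ..., n+m-1} for m <= n. *)
Definition angle (n m : nat) : seq nat :=
  [seq (n - m + 1 + 2 * j)%N | j <- iota 0 m].

(* Main.v *)
Require Import Defs.
From mathcomp Require Import all_boot all_order all_algebra.
From mathcomp Require Import all_fingroup all_solvable all_field all_character.
From mathcomp Require Import mpoly ring zify.

(** The simple module [V n] is the space of binary forms of degree [n - 1], and
    [V n (x) V m] is the space of bihomogeneous forms in two points [z], [w] of
    the plane. Equivariant maps between such spaces are written down and compared
    through values at points, over an infinite field; the invariant
    [area z w = z.1 * w.2 - z.2 * w.1] of a pair of points and polarization, the
    derivative in [z] in the direction [w], provide nearly all of them.

    First let [n < p]. Forms [area z w ^+ (m - 1) * f z] make up a copy of
    [V (n - m + 1)] in [V n (x) V m], and polarization embeds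
    [V (n + 1) (x) V (m - 1)]. These two submodules meet trivially
    ([polar_area_pow_inj]): a form divisible by the area vanishes on the diagonal,
    where polarization is multiplication by the invertible number [n]. Dimensions
    add up, so [V n (x) V m] is the direct sum of the two
    ([clebsch_gordan_step]). On the index sets this step removes the least element
    [n - m + 1] of [<n, m>], whose mirror image about [p] is out of range, and
    leaves [<n + 1, m - 1>]. Repeating it reduces everything to products
    [V p (x) V j] with the Steinberg module.

    These are projective. Projectivity is used in the form of Higman's criterion,
    which is inherited by tensor products and direct summands, and which makes
    projective modules injective; for [V p] it is checked on a Sylow subgroup, over
    which [V p] is the regular module of functions on the prime field
    ([higman_steinberg]). In particular [V p] is its own cover, which settles
    [j = 1]. For [j >= 2] the embedding of [V p (x) V (j - 2)] in [V p (x) V j],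
    polarization followed by multiplication by the area, has a projective
    complement [A], of dimension [2 * p]. Summing values of forms over the points of
    the plane over the prime field gives a map onto [V (p - j + 1)] that kills the
    multiples of the area, so [A] maps onto [V (p - j + 1)] and therefore onto its
    projective cover.

    It remains to see that the cover [P i] is large enough: at least [2 * p] for
    [1 < i < p], at least [p] for [i = 1] ([dim_projective_cover]). A projective
    module is free over the Sylow subgroup, so this amounts to finding two
    independent functionals on [P i] invariant under that subgroup, or one. They
    come from evaluation at a fixed point on [V i] and on [V (2 * p - i)], the
    latter mapping onto [V i]. Thus [A] is [P (p - j + 1)] for [j < p]. For [j = p] it
    maps onto both [V p], which splits off, and [V 1], so it is
    [V p (+) P 1]; this is where the extra summand for [n = m = p] comes from. *)

Set Implicit Arguments.
Unset Strict Implicit.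
Unset Printing Implicit Defensive.

Import GRing.Theory.
Local Open Scope ring_scope.

(** * Tensor products and Higman's criterion *)

Lemma inj_row_full (F : fieldType) m n (A : 'M[F]_(m, n)) :
  (forall q (X : 'M_(n, q)), A *m X = 0 -> X = 0) -> row_full A.
Proof.
move=> Ainj; rewrite /row_full -mxrank_tr -/(row_free A^T) -kermx_eq0.
apply/eqP; apply: trmx_inj; rewrite [RHS]trmx0; apply: Ainj.
by rewrite -[X in X *m _]trmxK -trmx_mul mulmx_ker trmx0.
Qed.

Section TensorProducts.
Variable F : fieldType.

Lemma tprod_linear_l m1 n1 m2 n2 (B : 'M[F]_(m2, n2)) :
  linear (fun A : 'M[F]_(m1, n1) => tprod A B).
Proof.
elim: m1 => [|m1 IH] c A A' /=; first by rewrite scaler0 addr0.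
rewrite linearP /= -!trowbE linearP /= [dsubmx _]linearP /= IH.
by rewrite -add_col_mx -scale_col_mx.
Qed.

Lemma tprod_linear_r m1 n1 m2 n2 (A : 'M[F]_(m1, n1)) :
  linear (fun B : 'M[F]_(m2, n2) => tprod A B).
Proof.
elim: m1 A => [|m1 IH] A c B B' /=; first by rewrite scaler0 addr0.
by rewrite linearP IH -add_col_mx -scale_col_mx.
Qed.

Local Arguments tprod : simpl never.

Lemma tprodDl m1 n1 m2 n2 (A A' : 'M[F]_(m1, n1)) (B : 'M[F]_(m2, n2)) :
  tprod (A + A') B = tprod A B + tprod A' B.
Proof. by have := tprod_linear_l B 1 A A'; rewrite !scale1r. Qed.

Lemma tprodZl m1 n1 m2 n2 c (A : 'M[F]_(m1, n1)) (B : 'M[F]_(m2, n2)) :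
  tprod (c *: A) B = c *: tprod A B.
Proof.
have t0 : tprod (0 : 'M[F]_(m1, n1)) B = 0.
  have := tprod_linear_l B (-1) 0 (0 : 'M_(m1, n1)).
  by rewrite scaleN1r oppr0 addr0 scaleN1r addNr.
by have := tprod_linear_l B c A 0; rewrite t0 !addr0.
Qed.

Lemma tprodDr m1 n1 m2 n2 (A : 'M[F]_(m1, n1)) (B B' : 'M[F]_(m2, n2)) :
  tprod A (B + B') = tprod A B + tprod A B'.
Proof. by have := tprod_linear_r A 1 B B'; rewrite !scale1r. Qed.

Lemma tprodZr m1 n1 m2 n2 c (A : 'M[F]_(m1, n1)) (B : 'M[F]_(m2, n2)) :
  tprod A (c *: B) = c *: tprod A B.
Proof.
have t0 : tprod A (0 : 'M[F]_(m2, n2)) = 0.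
  have := tprod_linear_r A (-1) 0 (0 : 'M_(m2, n2)).
  by rewrite scaleN1r oppr0 addr0 scaleN1r addNr.
by have := tprod_linear_r A c B 0; rewrite t0 !addr0.
Qed.

Lemma tprod_suml (I : Type) (r : seq I) (P : pred I) m1 n1 m2 n2
    (A : I -> 'M[F]_(m1, n1)) (B : 'M[F]_(m2, n2)) :
  tprod (\sum_(i <- r | P i) A i) B = \sum_(i <- r | P i) tprod (A i) B.
Proof.
apply: (big_morph (fun A => tprod A B)) => [x y|]; first exact: tprodDl.
by rewrite -(scale0r 0) tprodZl scale0r.
Qed.

Lemma tprod_sumr (I : Type) (r : seq I) (P : pred I) m1 n1 m2 n2
    (A : 'M[F]_(m1, n1)) (B : I -> 'M[F]_(m2, n2)) :
  tprod A (\sum_(i <- r | P i) B i) = \sum_(i <- r | P i) tprod A (B i).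
Proof.
apply: (big_morph (fun B => tprod A B)) => [x y|]; first exact: tprodDr.
by rewrite -(scale0r 0) tprodZr scale0r.
Qed.

Lemma mx1_sum n : (1%:M : 'M[F]_n) =
  \sum_(i < n) delta_mx i (0 : 'I_1) *m delta_mx (0 : 'I_1) i.
Proof.
rewrite mx1_sum_delta; apply: eq_bigr => i _.
by rewrite mul_delta_mx.
Qed.

Lemma tprod1_sum m n : (1%:M : 'M[F]_(m * n)) =
  \sum_(i < m) \sum_(j < n)
    tprod (delta_mx i (0 : 'I_1)) (delta_mx j (0 : 'I_1)) *m
    tprod (delta_mx (0 : 'I_1) i) (delta_mx (0 : 'I_1) j).
Proof.
rewrite -tprod1 {1}mx1_sum tprod_suml; apply: eq_bigr => i _.
rewrite mx1_sum tprod_sumr; apply: eq_bigr => j _.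
by rewrite tprodE.
Qed.

Lemma tprod_eq0 m n q (X : 'M[F]_(m * n, q)) :
  (forall i j, tprod (delta_mx (0 : 'I_1) i) (delta_mx (0 : 'I_1) j) *m X = 0) ->
  X = 0.
Proof.
move=> X0; rewrite -[X]mul1mx tprod1_sum mulmx_suml big1 // => i _.
by rewrite mulmx_suml big1 // => j _; rewrite -mulmxA X0 mulmx0.
Qed.

(** The map [v (x) w |-> u(v) w]. Writing it as a sum over a basis avoids
    identifying [1 * n] with [n] in the format of matrices. *)
Definition contract m n (u : 'rV[F]_m) : 'M[F]_(n, m * n) :=
  \sum_(i < n) delta_mx i (0 : 'I_1) *m tprod u (delta_mx (0 : 'I_1) i).

Lemma contract_tprod m n q r (u : 'rV[F]_m) (A : 'M[F]_(m, q)) (B : 'M[F]_(n, r)) :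
  contract n u *m tprod A B = B *m contract r (u *m A).
Proof.
rewrite mulmx_suml mulmx_sumr.
have -> : \sum_(i < r) B *m (delta_mx i (0 : 'I_1) *m
      tprod (u *m A) (delta_mx (0 : 'I_1) i)) =
    \sum_(l < n) delta_mx l (0 : 'I_1) *m
      \sum_(i < r) (delta_mx (0 : 'I_1) l *m B *m delta_mx i (0 : 'I_1) *m
        tprod (u *m A) (delta_mx (0 : 'I_1) i)).
  under [in RHS]eq_bigr => l _ do rewrite mulmx_sumr.
  rewrite exchange_big /=; apply: eq_bigr => i _.
  under eq_bigr => l _ do rewrite !mulmxA.
  by rewrite -!mulmx_suml -mx1_sum mul1mx mulmxA.
apply: eq_bigr => l _; rewrite -mulmxA; congr (_ *m _).
transitivity (tprod (u *m A) (delta_mx (0 : 'I_1) l *m B)).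
  by rewrite (tprodE u A (delta_mx (0 : 'I_1) l) B).
rewrite -[X in tprod _ X]mulmx1 mx1_sum mulmx_sumr tprod_sumr.
apply: eq_bigr => i _.
rewrite !mulmxA; set c := _ *m delta_mx i 0.
by rewrite [c]mx11_scalar !mul_scalar_mx tprodZr.
Qed.

Lemma contractD m n (u v : 'rV[F]_m) :
  contract n (u + v) = contract n u + contract n v.
Proof.
rewrite /contract -big_split; apply: eq_bigr => i _.
by rewrite tprodDl mulmxDr.
Qed.

Lemma contract_sum (I : finType) (P : pred I) m n (u : I -> 'rV[F]_m) :
  contract n (\sum_(i | P i) u i) = \sum_(i | P i) contract n (u i).
Proof.
apply: (big_morph (fun u => contract n u)) => [x y|]; first exact: contractD.
rewrite /contract big1 // => i _.
by rewrite -(scale0r 0) tprodZl scale0r mulmx0.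
Qed.

Lemma contract_free m n (u : 'rV[F]_m) : u != 0 -> row_free (contract n u).
Proof.
move=> u0; apply/row_freeP.
have [v uv] : exists v : 'cV_m, u *m v = 1%:M.
  apply/row_freeP; rewrite /row_free eqn_leq rank_leq_row /=.
  by rewrite lt0n mxrank_eq0.
exists (tprod v 1%:M *m (\sum_(i < n)
  tprod (1%:M : 'M_1) (delta_mx i (0 : 'I_1)) *m delta_mx (0 : 'I_1) i)).
rewrite mulmxA contract_tprod uv mul1mx mulmx_sumr.
rewrite [RHS]mx1_sum; apply: eq_bigr => i _.
rewrite mulmxA contract_tprod mulmx1 -mulmxA; congr (_ *m _).
rewrite /contract big_ord1 -[RHS]mul1mx; congr (_ *m _).
have -> : delta_mx 0 0 = 1%:M :> 'M[F]_1.
  by apply/matrixP => a b; rewrite !ord1 !mxE eqxx.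
by rewrite mul1mx tprod1.
Qed.

End TensorProducts.

Local Arguments tprod : simpl never.

Section RelativeProjectivity.
Variables (k : fieldType) (gT : finGroupType) (G : {group gT}).
Implicit Types M N P Q W : representation k G.

Definition tens M N : representation k G := Representation (prod_repr M N).

(** D. Higman's criterion for projectivity: the identity is a trace from the
    trivial subgroup. Unlike a lifting property, it passes to tensor products,
    to summands and to subgroups by a one-line computation. *)
Definition higman M : Prop :=
  exists th : 'M[k]_(rdegree M), \sum_(g in G) M g *m th *m M g^-1%g = 1%:M.

Lemma is_hom_mul M N P (f : 'M_(rdegree N, rdegree M)) (h : 'M_(rdegree P, rdegree N)) :
  is_hom f -> is_hom h -> is_hom (h *m f).
Proof. by move=> hf hh g gG; rewrite -mulmxA hf // mulmxA hh // mulmxA. Qed.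

Lemma is_hom_sum_conj M N (X : 'M_(rdegree N, rdegree M)) :
  is_hom (\sum_(g in G) N g *m X *m M g^-1%g).
Proof.
move=> h hG; rewrite mulmx_suml mulmx_sumr.
rewrite (reindex_inj (mulgI h)) /=.
apply: eq_big => [g|g gG]; first by rewrite groupMl.
rewrite groupMl // in gG.
rewrite repr_mxM // invMg repr_mxM ?groupV // -!mulmxA.
by rewrite -repr_mxM ?groupV // mulVg repr_mx1 mulmx1.
Qed.

(** Average an arbitrary linear lift, weighted by the [th] of the criterion. *)
Lemma higman_projective P : higman P -> projective P.
Proof.
move=> [th th1] M N e f [he fe] hf.
have [s es] := row_freeP fe.
exists (\sum_(g in G) M g *m (s *m f *m th) *m P g^-1%g).
  exact: is_hom_sum_conj.
rewrite mulmx_sumr -[RHS]mulmx1 -th1 mulmx_sumr; apply: eq_bigr => g gG.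
by rewrite !mulmxA he // -(mulmxA (N g)) es mulmx1 -hf.
Qed.

(** Higman's criterion is symmetric under duality, so it gives injectivity as
    well as projectivity. *)
Lemma higman_retraction W Q (f : 'M_(rdegree Q, rdegree W)) :
    higman W -> is_hom f -> row_full f ->
  exists2 r : 'M_(rdegree W, rdegree Q), is_hom r & r *m f = 1%:M.
Proof.
move=> [th th1] hf /row_fullP [s sf].
exists (\sum_(g in G) W g *m (th *m s) *m Q g^-1%g); first exact: is_hom_sum_conj.
rewrite mulmx_suml -th1; apply: eq_bigr => g gG.
by rewrite -!mulmxA -hf ?groupV // (mulmxA s) sf mul1mx.
Qed.

Lemma higman_tens M N : higman M -> higman (tens M N).
Proof.
move=> [th th1]; exists (tprod th 1%:M); rewrite /= -tprod1 -th1 tprod_suml.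
apply: eq_bigr => g gG; rewrite -!tprodE mulmx1.
by rewrite -repr_mxM ?groupV // mulgV repr_mx1.
Qed.

(** The augmentation [k[G] (x) P -> P] splits when [P] is projective; the
    component at [1] of a section is the required [th], since equivariance
    determines the component at [g] as a conjugate of that at [1]. *)
Lemma projective_higman P : projective P -> higman P.
Proof.
move=> prP.
pose R : representation k G := Representation (regular_repr k G).
pose ones : 'rV[k]_(rdegree R) := const_mx 1.
pose del (g : gT) : 'rV[k]_(rdegree R) := delta_mx 0 (gring_index G g).
have onesR g : g \in G -> ones *m R g = ones.
  move=> gG; apply/rowP => j; rewrite !mxE /=.
  rewrite (bigD1 (gring_index G (enum_val j * g^-1))) //= big1 => [|i ni].
    rewrite !mxE gring_indexK ?groupM ?groupV ?enum_valP // mulgKV gring_valK.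
    by rewrite !eqxx mulr1 addr0.
  rewrite !mxE eqxx /=; case: eqP => [e|]; last by rewrite mulr0.
  by case/eqP: ni; rewrite e gring_indexK ?groupM ?enum_valP // mulgK gring_valK.
have delR g : g \in G -> del 1%g *m R g = del g.
  by move=> gG; rewrite /del -rowE rowK gring_indexK // mul1g.
have onesE : ones = \sum_(g in G) del g.
  rewrite (reindex_onto (fun i : 'I_#|G| => enum_val i)
             (fun g => gring_index G g)) /=; last first.
    by move=> g gG; rewrite gring_indexK.
  apply/rowP => j; rewrite !mxE summxE (bigD1 j) /=; last first.
    by rewrite enum_valP gring_valK eqxx.
  rewrite !mxE gring_valK !eqxx big1 ?addr0 // => i /andP [_ nij].
  by rewrite mxE gring_valK eqxx eq_sym (negPf nij).
pose e : 'M_(rdegree P, rdegree (tens R P)) := contract (rdegree P) ones.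
have he : is_epi (M := tens R P) (N := P) e.
  split=> [g gG|].
    by rewrite /e /= contract_tprod onesR.
  apply: contract_free; apply/eqP => /rowP /(_ (gring_index G 1%g)).
  by rewrite !mxE => /eqP; rewrite oner_eq0.
have h1 : is_hom (M := P) (N := P) 1%:M by move=> g gG; rewrite mul1mx mulmx1.
have [h hh eh] := prP _ _ _ _ he h1.
exists (contract (rdegree P) (del 1%g) *m h).
rewrite -eh /e onesE contract_sum [RHS]mulmx_suml (reindex_inj invg_inj).
apply: eq_big => [g|g gG]; first by rewrite groupV.
rewrite groupV in gG; rewrite invgK -!mulmxA hh //= [contract _ _ *m (_ *m h)]mulmxA.
rewrite contract_tprod delR // !mulmxA -repr_mxM ?groupV // mulVg repr_mx1.
by rewrite mul1mx.
Qed.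

(** A separate lemma, since [\rank e] occurs in the types of the two factors. *)
Lemma idempotent_splitting n (e : 'M[k]_n) : e *m e = e ->
  exists d (i : 'M_(n, d)) (q : 'M_(d, n)), i *m q = e /\ q *m i = 1%:M.
Proof.
move=> ee.
have [d [i [q [/row_fullP [i' i'i] [/row_freeP [q' qq'] iq]]]]] :
    exists d (i : 'M_(n, d)) (q : 'M_(d, n)), row_full i /\ row_free q /\ i *m q = e.
  exists (\rank e), (col_base e), (row_base e).
  by rewrite col_base_full row_base_free mulmx_base.
exists d, i, q; split=> //.
have: i' *m (e *m e) *m q' = i' *m e *m q' by rewrite ee.
by rewrite -iq !mulmxA i'i !mul1mx qq' -(mulmxA _ q q') qq' mulmx1.
Qed.

(** The complement [K] is the image of the projector [1 - f r]. It is given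
    with its inclusion [i] and its projection [q], so that maps out of [Q] can
    be restricted to it. *)
Lemma complement W Q (f : 'M_(rdegree Q, rdegree W)) (r : 'M_(rdegree W, rdegree Q)) :
    is_hom f -> is_hom r -> r *m f = 1%:M ->
  exists (K : representation k G) (i : 'M_(rdegree Q, rdegree K))
         (q : 'M_(rdegree K, rdegree Q)),
    [/\ is_hom i, f *m r + i *m q = 1%:M,
        (rdegree W + rdegree K)%N = rdegree Q,
        mx_rsim Q (dadd_grepr W K) & higman Q -> higman K].
Proof.
move=> hf hr rf; pose e := 1%:M - f *m r.
have he : is_hom (M := Q) (N := Q) e.
  by move=> g gG; rewrite mulmxBl mulmxBr mul1mx mulmx1 -mulmxA hr // !mulmxA hf.
have re : r *m e = 0 by rewrite mulmxBr mulmx1 mulmxA rf mul1mx subrr.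
have ee : e *m e = e by rewrite {1}/e mulmxBl mul1mx -mulmxA re mulmx0 subr0.
have [d [i [q [iq qi]]]] := idempotent_splitting ee.
have ei : e *m i = i by rewrite -iq -mulmxA qi mulmx1.
have qe : q *m e = q by rewrite -iq mulmxA qi mul1mx.
have reprK : mx_repr G (fun g => q *m Q g *m i).
  split=> [|g h gG hG]; first by rewrite repr_mx1 mulmx1.
  rewrite !mulmxA -(mulmxA _ i q) iq -(mulmxA q _ e) -(he g gG) mulmxA qe.
  by rewrite repr_mxM // mulmxA.
pose K : representation k G := Representation (MxRepresentation reprK).
have hi : is_hom (M := K) (N := Q) i.
  by move=> g gG; rewrite /= !mulmxA iq he // -mulmxA ei.
have sum1 : f *m r + i *m q = 1%:M by rewrite iq addrC subrK.
have ri : r *m i = 0 by rewrite -ei mulmxA re mul0mx.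
have qf : q *m f = 0.
  by rewrite -qe -mulmxA mulmxBl mul1mx -mulmxA rf mulmx1 subrr mulmx0.
have BC : row_mx f i *m col_mx r q = 1%:M by rewrite mul_row_col.
have CB : col_mx r q *m row_mx f i = 1%:M.
  by rewrite mul_col_row rf ri qf qi -scalar_mx_block.
have dimE : (rdegree W + rdegree K)%N = rdegree Q.
  apply/eqP; rewrite eqn_leq; apply/andP; split.
    rewrite -(mxrank1 k (rdegree W + _)) -CB (leq_trans (mxrankM_maxl _ _)) //.
    exact: rank_leq_col.
  rewrite -(mxrank1 k (rdegree Q)) -BC (leq_trans (mxrankM_maxl _ _)) //.
  exact: rank_leq_col.
exists K, i, q; split=> //.
  exists (row_mx f i) => //; first by apply/row_freeP; exists (col_mx r q).
  move=> g gG; rewrite mul_mx_row mul_row_block !mulmx0 addr0 add0r.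
  by rewrite hf // hi.
move=> [th th1]; exists (q *m th *m i).
transitivity (q *m (\sum_(g in G) Q g *m th *m Q g^-1%g) *m i); last first.
  by rewrite th1 mulmx1 qi.
rewrite [in RHS]mulmx_sumr [RHS]mulmx_suml; apply: eq_bigr => g gG.
rewrite /= !mulmxA -[q *m Q g *m i *m q]mulmxA iq -[q *m Q g *m e]mulmxA -he //.
rewrite !mulmxA qe -[_ *m i *m q]mulmxA iq -!mulmxA [e *m (_ *m i)]mulmxA.
by rewrite he ?groupV // -mulmxA ei.
Qed.

(** A map from a projective module onto [V] lifts to the cover [P], and the lift
    is onto because [P -> V] is essential. So a lower bound on the dimension of
    [P] is all that is needed to identify the two. *)
Lemma rsim_projective_cover Q P V (t : 'M_(rdegree V, rdegree Q)) :
  higman Q -> is_epi t -> projective_cover P V ->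
  (rdegree Q <= rdegree P)%N -> mx_rsim Q P.
Proof.
move=> hQ et [prP [e [[he fe] ess]]] dimQ.
have [h hh eh] := higman_projective hQ (conj he fe) (proj1 et).
have [_ fh] : is_epi h by apply: ess => //; rewrite eh.
apply: mx_rsim_sym; exists h => //; last by move=> g gG; rewrite hh.
apply/eqP; rewrite eqn_leq dimQ andbT.
by rewrite -(eqP fh) rank_leq_col.
Qed.

End RelativeProjectivity.

(** * Forms in one and two variables, through their values *)

Section Evaluation.
Variable k : closedFieldType.
Implicit Types z w : k * k.

(** A form of degree [n.-1] is handled through its values: [ev n z] is the
    functional sending its column of coefficients to its value at [z]. The field
    is infinite, so these rows span, and a matrix is determined by its products
    with them. *)
Definition ev n z : 'rV[k]_n := \row_(i < n) (z.1 ^+ (n.-1 - i) * z.2 ^+ i).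

(** The invariant of a pair of points under the special linear group. *)
Definition area z w : k := z.1 * w.2 - z.2 * w.1.

Lemma poly_eq0_horner (q : {poly k}) : (forall t, q.[t] = 0) -> q = 0.
Proof.
move=> q0; apply/eqP; apply/negP => /negP /closed_nonrootP [t /negP[]].
by apply/rootP.
Qed.

Lemma coef_eq0_cofinite n (c : 'I_n -> k) (x : k) :
  (forall y, y != x -> \sum_(j < n) y ^+ j * c j = 0) -> forall j, c j = 0.
Proof.
move=> c0 j.
pose q : {poly k} := \poly_(i < n) (if insub i is Some j then c j else 0).
have qE y : q.[y] = \sum_(j < n) y ^+ j * c j.
  by rewrite horner_poly; apply: eq_bigr => i _; rewrite valK mulrC.
have q0 : ('X - x%:P) * q = 0.
  apply: poly_eq0_horner => t; rewrite hornerM !hornerE qE.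
  have [->|nt] := eqVneq t x; first by rewrite subrr mul0r.
  by rewrite c0 ?mulr0.
move/eqP: q0; rewrite mulf_eq0 polyXsubC_eq0 /= => /eqP q0.
have := coef_poly n (fun i => if insub i is Some j then c j else 0) j.
by rewrite -/q q0 coef0 ltn_ord valK.
Qed.

Lemma ev1E n y : ev n (1, y) = \sum_(j < n) y ^+ j *: delta_mx 0 j.
Proof.
apply/rowP => i; rewrite !mxE summxE (bigD1 i) //= big1 => [|j nij].
  by rewrite !mxE !eqxx expr1n mul1r mulr1 addr0.
by rewrite !mxE eq_sym (negPf nij) andbF mulr0.
Qed.

(** Testing only pairs of points with nonzero area makes multiplication by the
    area injective, in [area_mx_inj]. *)
Lemma tprod_ev_eq0 a b q (X : 'M[k]_(a * b, q)) :
  (forall z w, area z w != 0 -> tprod (ev a z) (ev b w) *m X = 0) -> X = 0.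
Proof.
move=> X0; apply: tprod_eq0 => i j.
apply/rowP => l; rewrite [RHS]mxE.
pose c i j := (tprod (delta_mx (0 : 'I_1) i) (delta_mx (0 : 'I_1) j) *m X) 0 l.
change (c i j = 0).
have cE x y : y != x -> \sum_(j < b) y ^+ j * (\sum_(i < a) x ^+ i * c i j) = 0.
  move=> nxy.
  have := X0 (1, x) (1, y); rewrite /area /= mul1r mulr1 subr_eq0 => /(_ nxy).
  move/rowP/(_ l); rewrite [RHS]mxE; apply: etrans.
  rewrite !ev1E tprod_suml mulmx_suml summxE.
  under [RHS]eq_bigr => i' _.
    rewrite tprodZl tprod_sumr -scalemxAl mulmx_suml mxE summxE.
    under eq_bigr => j' _ do rewrite tprodZr -scalemxAl mxE.
    rewrite mulr_sumr; over.
  rewrite [RHS]exchange_big /=; apply: eq_bigr => j' _; rewrite mulr_sumr.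
  by apply: eq_bigr => i' _; rewrite /c mulrCA.
have c1 x : forall j, \sum_(i < a) x ^+ i * c i j = 0.
  by apply: (@coef_eq0_cofinite b _ x) => y; apply: cE.
by apply: (@coef_eq0_cofinite a (fun i => c i j) 0) => x _; apply: c1.
Qed.

Lemma ev_eq0 n q (X : 'M[k]_(n, q)) : (forall z, ev n z *m X = 0) -> X = 0.
Proof.
move=> X0; apply/matrixP => i l; rewrite mxE.
apply: (@coef_eq0_cofinite n (fun i => X i l) 0) => y _.
have /rowP /(_ l) := X0 (1, y); rewrite !mxE; apply: etrans.
by apply: eq_bigr => j _; rewrite mxE expr1n mul1r.
Qed.

Lemma ev_inj n q (X Y : 'M[k]_(n, q)) :
  (forall z, ev n z *m X = ev n z *m Y) -> X = Y.
Proof.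
move=> XY; apply/eqP; rewrite -subr_eq0; apply/eqP/ev_eq0 => z.
by rewrite mulmxBr XY subrr.
Qed.

Lemma tprod_ev_inj a b q (X Y : 'M[k]_(a * b, q)) :
  (forall z w, tprod (ev a z) (ev b w) *m X = tprod (ev a z) (ev b w) *m Y) -> X = Y.
Proof.
move=> XY; apply/eqP; rewrite -subr_eq0; apply/eqP/tprod_ev_eq0 => z w _.
by rewrite mulmxBr XY subrr.
Qed.

Definition mulX n : 'M[k]_(n.+1, n) := \matrix_(i, j) (i == j :> nat)%:R.
Definition mulY n : 'M[k]_(n.+1, n) := \matrix_(i, j) (i == j.+1 :> nat)%:R.

Definition derX n : 'M[k]_(n, n.+1) :=
  \matrix_(i, j) ((i == j :> nat)%:R *+ (n - j)).
Definition derY n : 'M[k]_(n, n.+1) :=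
  \matrix_(i, j) ((i.+1 == j :> nat)%:R *+ j).

Lemma ev_mulX n z : ev n.+1 z *m mulX n = z.1 *: ev n z.
Proof.
apply/rowP => j; rewrite !mxE (bigD1 (widen_ord (leqnSn n) j)) //= big1 => [|i nij].
  rewrite !mxE /= eqxx mulr1 addr0 mulrA -exprS; congr (_ ^+ _ * _).
  by case: n j => [[]|n] //= j; rewrite subSn // -ltnS.
rewrite !mxE; case: eqP => [e|]; last by rewrite mulr0.
by case/eqP: nij; apply: val_inj.
Qed.

Lemma ev_mulY n z : ev n.+1 z *m mulY n = z.2 *: ev n z.
Proof.
apply/rowP => j; rewrite !mxE (bigD1 (lift ord0 j)) //= big1 => [|i nij].
  rewrite !mxE /= eqxx mulr1 addr0 exprS.
  have -> : (n - bump 0 j)%N = (n.-1 - j)%N by rewrite /bump /= add1n subnS -!subn1 subnAC.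
  by ring.
rewrite !mxE; case: eqP => [e|]; last by rewrite mulr0.
by case/eqP: nij; apply: val_inj.
Qed.

(** The derivative at [z] in the direction [w], as a functional on forms. *)
Definition dev n z w : 'rV[k]_n.+1 :=
  w.1 *: (ev n z *m derX n) + w.2 *: (ev n z *m derY n).

(** The [i]-th monomial along the line through [z] directed by [w]: identities
    between directional derivatives follow from identities between values. *)
Definition line_poly n z w (i : 'I_n.+1) : {poly k} :=
  (z.1%:P + w.1 *: 'X) ^+ (n - i) * (z.2%:P + w.2 *: 'X) ^+ i.

Lemma line_polyE n z w i t :
  (line_poly z w i).[t] = ev n.+1 (z.1 + t * w.1, z.2 + t * w.2) 0 i.
Proof. by rewrite /line_poly !hornerE !mxE /= ![_ * t]mulrC. Qed.

Lemma ev_derX n z i :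
  (ev n z *m derX n) 0 i = (z.1 ^+ (n.-1 - i) * z.2 ^+ i) *+ (n - i).
Proof.
rewrite mxE; have [ltin|leni] := ltnP i n; last first.
  rewrite (eqP leni) mulr0n big1 // => j _.
  by rewrite !mxE (eqP leni) mulr0n mulr0.
rewrite (bigD1 (Ordinal ltin)) //= big1 => [|j nij].
  by rewrite !mxE eqxx addr0 mulrnAr mulr1.
rewrite !mxE; case: eqP => [e|]; last by rewrite mul0rn mulr0.
by case/eqP: nij; apply: val_inj.
Qed.

Lemma ev_derY n z i :
  (ev n z *m derY n) 0 i = (z.1 ^+ (n - i) * z.2 ^+ i.-1) *+ i.
Proof.
rewrite mxE; case: (unliftP ord0 i) => [i' ->|->]; last first.
  by rewrite big1 ?mulr0n // => j _; rewrite !mxE mulr0n mulr0.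
rewrite (bigD1 i') //= big1 => [|j nij].
  rewrite !mxE /= eqxx addr0 mulrnAr mulr1 /bump /= add1n /=.
  by rewrite subnS -!subn1 subnAC.
rewrite !mxE /=; case: eqP => [e|]; last by rewrite mul0rn mulr0.
by case/eqP: nij; apply: val_inj; case: e.
Qed.

Lemma devE n z w i : dev n z w 0 i = (line_poly z w i)^`().[0].
Proof.
have dL (a b : k) : (a%:P + b *: 'X)^`() = b%:P.
  by rewrite derivD derivC add0r derivZ derivX alg_polyC.
rewrite /line_poly derivM !deriv_exp !dL !hornerE /= ?mulr0 ?addr0.
have -> : dev n z w 0 i = w.1 * (ev n z *m derX n) 0 i + w.2 * (ev n z *m derY n) 0 i.
  by rewrite [LHS]mxE !(mxE, mxE).
rewrite ev_derX ev_derY.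
have -> : (n.-1 - i)%N = (n - i).-1 by rewrite -!subn1 subnAC.
rewrite !hornerMn !hornerM !horner_exp !hornerE ?mulr0 ?scaler0 ?addr0.
by rewrite !mulrnAl !mulrnAr; congr (_ *+ _ + _ *+ _); ring.
Qed.

(** Euler's identity for homogeneous forms. *)
Lemma dev_diag n z : dev n z z = n%:R *: ev n.+1 z.
Proof.
apply/rowP => i.
have -> : dev n z z 0 i = z.1 * (ev n z *m derX n) 0 i + z.2 * (ev n z *m derY n) 0 i.
  by rewrite [LHS]mxE !(mxE, mxE).
rewrite ev_derX ev_derY !mxE /= -!mulrnAr.
have -> : z.1 * (z.1 ^+ (n.-1 - i) * (z.2 ^+ i *+ (n - i))) =
    (z.1 ^+ (n - i) * z.2 ^+ i) *+ (n - i).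
  rewrite mulrA -exprS mulrnAr; case e: (n - i)%N => [|d] //.
  by congr (_ ^+ _ * _ *+ _); rewrite -subn1 subnAC e subn1.
have -> : z.2 * (z.1 ^+ (n - i) * (z.2 ^+ i.-1 *+ i)) =
    (z.1 ^+ (n - i) * z.2 ^+ i) *+ i.
  by rewrite mulrCA mulrnAr -exprS mulrnAr; case: (i : nat).
by rewrite -mulrnDr subnK ?mulr_natl // -ltnS.
Qed.

(** Elements of [V a (x) V b] are the bihomogeneous forms in two points [z]
    and [w]. Three equivariant maps between these spaces are used:
    multiplication by [area z w], polarization (the derivative at [z] in the
    direction [w]), and restriction to the diagonal [w = z]. *)
Definition area_mx a b : 'M[k]_(a.+1 * b.+1, a * b) :=
  tprod (mulX a) (mulY b) - tprod (mulY a) (mulX b).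

Definition polar_mx a b : 'M[k]_(a * b.+1, a.+1 * b) :=
  tprod (derX a) (mulX b) + tprod (derY a) (mulY b).

Definition diag_mul_mx a b : 'M[k]_((a + b).-1, a * b) :=
  \sum_(i < a) \sum_(j < b) (\col_l (l == (i + j)%N :> nat)%:R) *m
     tprod (delta_mx (0 : 'I_1) i) (delta_mx (0 : 'I_1) j).

Lemma area_mxE a b z w :
  tprod (ev a.+1 z) (ev b.+1 w) *m area_mx a b =
  area z w *: tprod (ev a z) (ev b w).
Proof.
rewrite /area_mx mulmxBr -!(tprodE (ev _ z)) !ev_mulX !ev_mulY.
by rewrite !tprodZl !tprodZr !scalerA -scalerBl.
Qed.

Lemma polar_mxE a b z w :
  tprod (ev a z) (ev b.+1 w) *m polar_mx a b = tprod (dev a z w) (ev b w).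
Proof.
rewrite /polar_mx mulmxDr -!(tprodE (ev _ z)) !ev_mulX !ev_mulY.
by rewrite tprodDl !tprodZl !tprodZr.
Qed.

Lemma diag_mulE a b z :
  ev (a + b).-1 z *m diag_mul_mx a b = tprod (ev a z) (ev b z).
Proof.
have evE n : ev n z = \sum_(i < n) (z.1 ^+ (n.-1 - i) * z.2 ^+ i) *: delta_mx 0 i.
  apply/rowP => i; rewrite !mxE summxE (bigD1 i) //= big1 => [|j nij].
    by rewrite !mxE !eqxx mulr1 addr0.
  by rewrite !mxE eq_sym (negPf nij) andbF mulr0.
rewrite [ev a z]evE [ev b z]evE tprod_suml mulmx_sumr; apply: eq_bigr => i _.
rewrite tprod_sumr mulmx_sumr; apply: eq_bigr => j _.
rewrite tprodZl tprodZr scalerA mulmxA.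
set c := _ *m \col_l _; rewrite [c]mx11_scalar mul_scalar_mx; congr (_ *: _).
have ltij : (i + j < (a + b).-1)%N.
  by have := ltn_ord i; have := ltn_ord j; lia.
rewrite mxE (bigD1 (Ordinal ltij)) //= big1 => [|l nl]; last first.
  rewrite !mxE; case: eqP => [e|]; last by rewrite mulr0.
  by case/eqP: nl; apply: val_inj.
rewrite !mxE /= eqxx mulr1 addr0 [LHS]mulrC mulrACA -!exprD [RHS]mulrC; congr (_ * _ ^+ _).
by have := ltn_ord i; have := ltn_ord j; lia.
Qed.

Lemma area_mx_inj a b q (X : 'M_(a * b, q)) : area_mx a b *m X = 0 -> X = 0.
Proof.
move=> X0; apply: tprod_ev_eq0 => z w zw.
have := congr1 (mulmx (tprod (ev a.+1 z) (ev b.+1 w))) X0.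
rewrite mulmxA area_mxE mulmx0 -scalemxAl => /eqP.
by rewrite scaler_eq0 (negPf zw) => /eqP.
Qed.

Lemma diag_mul_area a b : diag_mul_mx a.+1 b.+1 *m area_mx a b = 0.
Proof.
apply: ev_eq0 => z; rewrite mulmxA diag_mulE area_mxE /area mulrC subrr.
exact: scale0r.
Qed.

Lemma tprod_scalar (x y : k) : tprod (x%:M : 'M[k]_1) (y%:M : 'M[k]_1) = (x * y)%:M.
Proof.
transitivity ((x * y) *: (1%:M : 'M[k]_1)); last by rewrite scalemx1.
rewrite -[x%:M]scalemx1 -[y%:M]scalemx1 tprodZl tprodZr scalerA.
by congr (_ *: _); apply: tprod1.
Qed.

Lemma diag_mul_free a b : row_free (diag_mul_mx a.+1 b.+1).
Proof.
have lti (l : 'I_(a.+1 + b.+1).-1) : (minn l a < a.+1)%N by rewrite ltnS geq_minr.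
have ltj (l : 'I_(a.+1 + b.+1).-1) : (l - minn l a < b.+1)%N.
  by have := ltn_ord l; lia.
apply/row_freeP.
(* The monomial of index [l] is a product of those of index [minn l a] and
   [l - minn l a]. *)
exists (\sum_(l < (a.+1 + b.+1).-1)
  tprod (delta_mx (Ordinal (lti l)) (0 : 'I_1))
        (delta_mx (Ordinal (ltj l)) (0 : 'I_1)) *m delta_mx (0 : 'I_1) l).
apply: ev_inj => z; rewrite mulmxA diag_mulE mulmx_sumr mx1_sum mulmx_sumr.
apply: eq_bigr => l _; rewrite !mulmxA; congr (_ *m _).
transitivity (tprod (col (Ordinal (lti l)) (ev a.+1 z))
                    (col (Ordinal (ltj l)) (ev b.+1 z))).
  by rewrite !colE (tprodE (ev a.+1 z) (delta_mx _ (0 : 'I_1)) (ev b.+1 z)).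
rewrite -colE [col _ (ev a.+1 _)]mx11_scalar [col _ (ev b.+1 _)]mx11_scalar.
rewrite [col _ (ev _.-1 _)]mx11_scalar.
rewrite [LHS]tprod_scalar !mxE /= mulrACA -!exprD; congr (_ ^+ _ * _ ^+ _)%:M.
  by have := ltn_ord l; lia.
by have := ltn_ord l; lia.
Qed.

(** A bihomogeneous form that vanishes on the diagonal is divisible by the
    area. The multiples of the area do vanish there, so it is enough to compare
    dimensions: [a * b] on one side, [a.+1 * b.+1 - (a + b).+1] on the other. *)
Lemma diag_mul_eq0 a b q (X : 'M_(a.+1 * b.+1, q)) :
  diag_mul_mx a.+1 b.+1 *m X = 0 -> exists Y, X = area_mx a b *m Y.
Proof.
move=> X0.
have free_area : row_free (area_mx a b)^T.
  have /eqP rA : row_full (area_mx a b).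
    by apply: inj_row_full => r; apply: area_mx_inj.
  by rewrite /row_free mxrank_tr rA.
have sub : ((area_mx a b)^T <= kermx (diag_mul_mx a.+1 b.+1)^T)%MS.
  by apply/sub_kermxP; rewrite -trmx_mul diag_mul_area trmx0.
have eqK : (kermx (diag_mul_mx a.+1 b.+1)^T <= (area_mx a b)^T)%MS.
  have [_ <-] := mxrank_leqif_sup sub.
  rewrite mxrank_ker (eqP free_area) mxrank_tr (eqP (diag_mul_free a b)).
  by apply/eqP; rewrite addSn /= mulnS mulSn addnS; lia.
have : (X^T <= (area_mx a b)^T)%MS.
  by apply: submx_trans eqK; apply/sub_kermxP; rewrite -trmx_mul X0 trmx0.
by case/submxP => Y XE; exists Y^T; rewrite -[X]trmxK XE trmx_mul trmxK.
Qed.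

Lemma dev_mulX n z w :
  dev n.+1 z w *m mulX n.+1 = w.1 *: ev n.+1 z + z.1 *: dev n z w.
Proof.
apply/rowP => j.
have -> : (dev n.+1 z w *m mulX n.+1) 0 j = dev n.+1 z w 0 (widen_ord (leqnSn _) j).
  rewrite mxE (bigD1 (widen_ord (leqnSn _) j)) //= big1 => [|i nij].
    by rewrite [mulX _ _ _]mxE /= eqxx mulr1 addr0.
  rewrite [mulX _ _ _]mxE; case: eqP => [e|]; last by rewrite mulr0.
  by case/eqP: nij; apply: val_inj.
have -> : (w.1 *: ev n.+1 z + z.1 *: dev n z w) 0 j =
    w.1 * ev n.+1 z 0 j + z.1 * dev n z w 0 j.
  by rewrite [LHS]mxE [X in X + _]mxE [X in _ + X]mxE.
rewrite !devE.
have -> : line_poly z w (widen_ord (leqnSn _) j) = (z.1%:P + w.1 *: 'X) * line_poly z w j.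
  by rewrite /line_poly /= mulrA -exprS subSn // -ltnS.
have q0 : (line_poly z w j).[0] = ev n.+1 z 0 j.
  by rewrite line_polyE !mul0r !addr0 -surjective_pairing.
move: (line_poly z w j) q0 => q <-.
rewrite derivM derivD derivC add0r derivZ derivX alg_polyC !hornerE.
by rewrite ?mulr0 ?scaler0 ?addr0.
Qed.

Lemma dev_mulY n z w :
  dev n.+1 z w *m mulY n.+1 = w.2 *: ev n.+1 z + z.2 *: dev n z w.
Proof.
apply/rowP => j.
have -> : (dev n.+1 z w *m mulY n.+1) 0 j = dev n.+1 z w 0 (lift ord0 j).
  rewrite mxE (bigD1 (lift ord0 j)) //= big1 => [|i nij].
    by rewrite [mulY _ _ _]mxE /= eqxx mulr1 addr0.
  rewrite [mulY _ _ _]mxE; case: eqP => [e|]; last by rewrite mulr0.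
  by case/eqP: nij; apply: val_inj.
have -> : (w.2 *: ev n.+1 z + z.2 *: dev n z w) 0 j =
    w.2 * ev n.+1 z 0 j + z.2 * dev n z w 0 j.
  by rewrite [LHS]mxE [X in X + _]mxE [X in _ + X]mxE.
rewrite !devE.
have -> : line_poly z w (lift ord0 j) = (z.2%:P + w.2 *: 'X) * line_poly z w j.
  by rewrite /line_poly /= /bump add1n subSS exprS; ring.
have q0 : (line_poly z w j).[0] = ev n.+1 z 0 j.
  by rewrite line_polyE !mul0r !addr0 -surjective_pairing.
move: (line_poly z w j) q0 => q <-.
rewrite derivM derivD derivC add0r derivZ derivX alg_polyC !hornerE.
by rewrite ?mulr0 ?scaler0 ?addr0.
Qed.

(** The derivation by which [z] moves in the direction [w] kills [area z w]. *)
Lemma polar_area a b :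
  polar_mx a.+1 b.+1 *m area_mx a.+1 b = area_mx a b.+1 *m polar_mx a b.
Proof.
apply: tprod_ev_inj => z w.
rewrite !mulmxA polar_mxE area_mxE -scalemxAl polar_mxE /area_mx mulmxBr.
rewrite -!(tprodE (dev _ _ _)) dev_mulX dev_mulY ev_mulX ev_mulY.
move: (dev a z w) => d.
rewrite !tprodDl !tprodZl !tprodZr /area scalerBl ?scalerDr !scalerA.
by rewrite [w.1 * w.2]mulrC opprD addrACA subrr add0r.
Qed.

(** On the diagonal polarization is multiplication by the degree, by Euler's
    identity. *)
Lemma diag_mul_polar_eq0 a b q (X : 'M_(a.+1 * b, q)) :
  a%:R != 0 :> k -> diag_mul_mx a b.+1 *m (polar_mx a b *m X) = 0 ->
  diag_mul_mx a.+1 b *m X = 0.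
Proof.
move=> a0 X0; apply: ev_eq0 => z; rewrite mulmxA diag_mulE.
have := congr1 (mulmx (ev _ z)) X0.
rewrite !mulmxA diag_mulE polar_mxE dev_diag tprodZl mulmx0 -scalemxAl => /eqP.
by rewrite scaler_eq0 (negPf a0) => /eqP.
Qed.

(** The map [f |-> area z w ^+ m * f z], whose values have degree [m] in [w]. *)
Fixpoint area_pow_mx c m : 'M[k]_((m + c) * m.+1, c) :=
  if m is m'.+1 then area_mx (m' + c) m'.+1 *m area_pow_mx c m'
  else \sum_(i < c)
         tprod (delta_mx i (0 : 'I_1)) (1%:M : 'M_1) *m delta_mx (0 : 'I_1) i.

Lemma area_pow_mxE c m z w :
  tprod (ev (m + c) z) (ev m.+1 w) *m area_pow_mx c m = area z w ^+ m *: ev c z.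
Proof.
elim: m => [|m IH] /=; last by rewrite mulmxA area_mxE -scalemxAl IH scalerA exprS.
have -> : ev 1 w = 1%:M by apply/matrixP => i j; rewrite !mxE !ord1 mulr1.
rewrite scale1r mulmx_sumr -[RHS]mulmx1 [X in _ = _ *m X]mx1_sum [RHS]mulmx_sumr.
apply: eq_bigr => i _; rewrite !mulmxA; congr (_ *m _).
transitivity (tprod (ev c z *m delta_mx i (0 : 'I_1)) (1%:M *m (1%:M : 'M[k]_1))).
  by rewrite (tprodE (ev c z) (delta_mx i (0 : 'I_1)) 1%:M).
by rewrite mulmx1 [_ *m delta_mx i 0]mx11_scalar [LHS]tprod_scalar mulr1.
Qed.

(** The map of the recursion step is injective. Restricting a relation to the
    diagonal shows that [X] vanishes there, hence is a multiple of the area; the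
    area then cancels, leaving the same relation with [m] lowered by one. The
    degrees met on the way, at most [m + c], have to be invertible. *)
Lemma polar_area_pow_inj c m q X (Y : 'M_(c, q)) :
  (forall l, (0 < l <= m + c)%N -> l%:R != 0 :> k) ->
  polar_mx (m + c) m *m X + area_pow_mx c m *m Y = 0 -> X = 0 /\ Y = 0.
Proof.
elim: m X => [|m IH] X nz XY0.
  have X0 : X = 0 by apply: tprod_eq0 => i [].
  split=> //; move: XY0; rewrite X0 mulmx0 add0r => Y0.
  apply: ev_eq0 => z; have := area_pow_mxE c 0 z z.
  by rewrite expr0 scale1r => <-; rewrite -mulmxA Y0 mulmx0.
have [|X1 XE] := @diag_mul_eq0 (m.+1 + c) m _ X.
  apply: diag_mul_polar_eq0; first by apply: nz; rewrite leqnn.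
  have := congr1 (mulmx (diag_mul_mx (m.+1 + c) m.+2)) XY0.
  by rewrite mulmx0 mulmxDr /= !mulmxA diag_mul_area !mul0mx addr0.
move: XY0; rewrite XE mulmxA polar_area /= -!mulmxA -mulmxDr => /area_mx_inj.
case/IH => [l /andP [l0 lm]|-> ->]; last by rewrite mulmx0.
by apply: nz; rewrite l0 (leq_trans lm).
Qed.

End Evaluation.

(** * Equivariance and the Clebsch-Gordan recursion *)

Lemma det_mx22 (R : comNzRingType) (A : 'M[R]_2) :
  \det A = A 0 0 * A 1 1 - A 0 1 * A 1 0.
Proof.
have l1 : lift 0 0 = 1 :> 'I_2 by apply: val_inj.
have l0 : lift 1 0 = 0 :> 'I_2 by apply: val_inj.
rewrite (expand_det_row _ 0) !big_ord_recl big_ord0 addr0 l1.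
rewrite /cofactor !det_mx11 !mxE l0 l1 /= expr0 expr1; ring.
Qed.

Section Equivariance.
Variables (k : closedFieldType) (p : nat).
Hypothesis charkp : p \in [pchar k].
Implicit Types (z w : k * k) (g h : {'GL_2(p)}).
Local Notation Fp := (@Fp_embed k p).
Local Notation V n := (V_repr charkp n).

(** The row action of [g] on points, for which [ev] is equivariant. *)
Definition act_pt g z : k * k :=
  (Fp (g 0 0) * z.1 + Fp (g 1 0) * z.2, Fp (g 0 1) * z.1 + Fp (g 1 1) * z.2).

Lemma ev_poly n (v : 'cV[k]_n) z :
  (ev n z *m v) 0 0 =
  (poly_of_cV v).@[fun i : 'I_2 => if i == 0 then z.1 else z.2].
Proof.
rewrite /poly_of_cV raddf_sum mxE; apply: eq_bigr => i _ /=.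
rewrite mevalZ mevalX mulrC; congr (_ * _).
by rewrite !big_ord_recl big_ord0 !mnmE mulr1 mxE.
Qed.

Lemma ev_V n z g : ev n z *m V_mx k n g = ev n (act_pt g z).
Proof.
apply/trmx_inj/row_matrixP => j; rewrite -!tr_col; congr (_^T).
rewrite [LHS]mx11_scalar [RHS]mx11_scalar; congr (_%:M).
rewrite !colE -mulmxA !ev_poly -act_poly_cV /act_poly comp_mpoly_meval.
apply: meval_eq => i; rewrite tnth_mktuple /subst_form raddf_sum /=.
rewrite !big_ord_recl big_ord0 addr0 /= !mevalZ !mevalXU /=.
have l1 : lift 0 0 = 1 :> 'I_2 by apply: val_inj.
by case: (unliftP 0 i) => [i' ->|->]; rewrite ?[i']ord1 !l1.
Qed.

Lemma area_act g z w : g \in SL2 p -> area (act_pt g z) (act_pt g w) = area z w.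
Proof.
rewrite inE det_mx22 => /eqP dg.
have fE : Fp (g 0 0) * Fp (g 1 1) = 1 + Fp (g 0 1) * Fp (g 1 0).
  have F1 : Fp 1 = 1 := Fp_embed_nat charkp 1.
  rewrite -!(Fp_embedM charkp) -F1 -(Fp_embedD charkp).
  by rewrite -dg subrK.
rewrite /area /act_pt /=.
transitivity ((Fp (g 0 0) * Fp (g 1 1) - Fp (g 0 1) * Fp (g 1 0)) *
              (z.1 * w.2 - z.2 * w.1)).
  by ring.
by rewrite fE addrK mul1r.
Qed.

Lemma dev_V n z w g : dev n z w *m V_mx k n.+1 g = dev n (act_pt g z) (act_pt g w).
Proof.
apply/rowP => j; rewrite mxE [RHS]devE.
have -> : line_poly (act_pt g z) (act_pt g w) j =
    \sum_i (V_mx k n.+1 g i j) *: line_poly z w i.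
  apply/eqP; rewrite -subr_eq0; apply/eqP/poly_eq0_horner => t.
  rewrite hornerD hornerN line_polyE horner_sum.
  have -> : ((act_pt g z).1 + t * (act_pt g w).1, (act_pt g z).2 + t * (act_pt g w).2) =
     act_pt g (z.1 + t * w.1, z.2 + t * w.2).
    by rewrite /act_pt /=; congr pair; ring.
  rewrite -ev_V mxE; apply/eqP; rewrite subr_eq0; apply/eqP/eq_bigr => i _.
  by rewrite hornerZ line_polyE mulrC.
rewrite (raddf_sum (@deriv _)) horner_sum; apply: eq_bigr => i _.
by rewrite /= derivZ hornerZ devE mulrC.
Qed.

Lemma V_tprod_ev a b z w g :
  tprod (ev a z) (ev b w) *m tens (V a) (V b) g =
  tprod (ev a (act_pt g z)) (ev b (act_pt g w)).
Proof. by rewrite /= -(tprodE (ev a z)) !ev_V. Qed.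

Lemma hom_area a b :
  is_hom (M := tens (V a) (V b)) (N := tens (V a.+1) (V b.+1)) (area_mx k a b).
Proof.
move=> g gG; apply: tprod_ev_inj => z w.
rewrite !mulmxA area_mxE -scalemxAl !V_tprod_ev area_mxE.
by rewrite area_act.
Qed.

Lemma hom_polar a b :
  is_hom (M := tens (V a.+1) (V b)) (N := tens (V a) (V b.+1)) (polar_mx k a b).
Proof.
move=> g gG; apply: tprod_ev_inj => z w.
rewrite !mulmxA polar_mxE V_tprod_ev polar_mxE /=.
by rewrite -(tprodE (dev _ z w)) dev_V ev_V.
Qed.

Lemma hom_diag_mul a b :
  is_hom (M := tens (V a) (V b)) (N := V (a + b).-1) (diag_mul_mx k a b).
Proof.
move=> g gG; apply: ev_inj => z.
by rewrite !mulmxA ev_V !diag_mulE V_tprod_ev.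
Qed.

Lemma hom_area_pow c m :
  is_hom (M := V c) (N := tens (V (m + c)) (V m.+1)) (area_pow_mx k c m).
Proof.
move=> g gG; apply: tprod_ev_inj => z w.
by rewrite !mulmxA area_pow_mxE V_tprod_ev area_pow_mxE -scalemxAl ev_V area_act.
Qed.

(** The summand [V c], made of the multiples of [area ^+ m], and the image of
    polarization meet trivially and have complementary dimensions. Both degrees
    being below [p], iterating this step either exhausts the second factor or
    brings the first one up to the Steinberg module [V p]. *)
Lemma clebsch_gordan_step c m : (0 < m + c < p)%N ->
  mx_rsim (tens (V (m + c)) (V m.+1))
          (dadd_grepr (V c) (tens (V (m + c).+1) (V m))).
Proof.
move=> /andP [_ ltp].
pose B : 'M[k]_((m + c) * m.+1, c + (m + c).+1 * m) :=
  row_mx (area_pow_mx k c m) (polar_mx k (m + c) m).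
have dimE : ((m + c) * m.+1 = c + (m + c).+1 * m)%N by nia.
have Binj q (X : 'M_(c + (m + c).+1 * m, q)) : B *m X = 0 -> X = 0.
  rewrite -[X]vsubmxK mul_row_col addrC => /polar_area_pow_inj.
  case=> [l /andP [l0 lm]|-> ->]; last by rewrite col_mx0.
  by rewrite -(dvdn_pcharf charkp) gtnNdvd // (leq_ltn_trans lm).
exists B => //.
  by have /eqP rB := inj_row_full Binj; rewrite /row_free rB dimE.
move=> g gG; rewrite mul_mx_row mul_row_block !mulmx0 addr0 add0r.
by congr row_mx; symmetry; [apply: hom_area_pow | apply: hom_polar].
Qed.

Lemma Fp_embedX x e : Fp (x ^+ e) = Fp x ^+ e.
Proof.
elim: e => [|e IH]; first by rewrite !expr0; apply: (Fp_embed_nat charkp 1).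
by rewrite !exprS (Fp_embedM charkp) IH.
Qed.

Lemma Fp_embed_eq0 x : (Fp x == 0) = (x == 0).
Proof.
have p_pr := pcharf_prime charkp.
apply/idP/eqP => [|->]; last by rewrite (Fp_embed_nat charkp 0).
rewrite /Fp_embed -(dvdn_pcharf charkp) => dx; apply: val_inj => /=.
by case: (posnP x) dx => // x0 /(dvdn_leq x0); rewrite leqNgt -{2}(Fp_cast p_pr) ltn_ord.
Qed.

Lemma Fp_embed_inj : injective Fp.
Proof.
move=> x y xy; apply/eqP; rewrite -subr_eq0 -Fp_embed_eq0.
have := Fp_embedD charkp (x - y) y; rewrite subrK xy => /esym/eqP.
by rewrite -[X in _ == X]add0r (inj_eq (addIr _)).
Qed.

(** If [p.-1] does not divide [e] then [x |-> x ^+ e] is a nontrivial character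
    of the multiplicative group, so its sum is invariant under multiplication
    by some constant other than [1]. *)
Lemma sum_Fp_expr e :
  \sum_(x : 'F_p) Fp x ^+ e = if (0 < e)%N && (p.-1 %| e)%N then -1 else 0.
Proof.
have p_pr := pcharf_prime charkp.
have p1 := prime_gt1 p_pr.
have cardF : #|'F_p| = p by rewrite card_Fp.
have unitX (x : 'F_p) : x != 0 -> x ^+ p.-1 = 1.
  move=> x0; apply: (mulfI x0); rewrite mulr1 -exprS prednK ?prime_gt0 //.
  by rewrite -{2}(expf_card x) cardF.
have sum1 : \sum_(x : 'F_p) (1 : k) = 0 by rewrite sumr_const cardF (pcharf0 charkp).
case: posnP => [->|e0] /=; first by under eq_bigr do rewrite expr0.
case: ifPn => [/dvdnP [q eq]|ndiv].
  have q0 : (0 < q)%N by case: q eq e0 => // ->.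
  have := sum1; rewrite (bigD1 0) //= => /eqP; rewrite addrC addr_eq0 => /eqP <-.
  rewrite (bigD1 0) //= (Fp_embed_nat charkp 0) expr0n.
  rewrite gtn_eqF // add0r.
  apply: eq_bigr => x x0; rewrite -Fp_embedX eq mulnC exprM unitX // expr1n.
  exact: (Fp_embed_nat charkp 1).
have [u u0 ue] : exists2 u : 'F_p, u != 0 & u ^+ e != 1.
  apply/exists_inP; apply: contraR ndiv; rewrite negb_exists_in => /forall_inP all1.
  pose r := (e %% p.-1)%N.
  have ltr : (r < p.-1)%N by rewrite ltn_mod -subn1 subn_gt0.
  rewrite /dvdn -/r; apply: contraTT isT => r0.
  have all_r (x : 'F_p) : x != 0 -> x ^+ r = 1.
    move=> x0; have := all1 x x0; rewrite negbK => /eqP.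
    by rewrite (divn_eq e p.-1) exprD mulnC exprM unitX // expr1n mul1r.
  pose f : {poly 'F_p} := 'X^r - 1.
  have sf : size f = r.+1 by rewrite size_XnsubC ?lt0n.
  have := @max_poly_roots _ f (enum (predC1 (0%R : 'F_p))).
  rewrite -size_poly_eq0 sf enum_uniq => /(_ isT) bad.
  suff : (size (enum (predC1 (0%R : 'F_p))) < r.+1)%N.
    by rewrite -cardE cardC1 cardF ltnS leqNgt ltr.
  apply: bad => //; apply/allP => x; rewrite mem_enum inE => x0.
  by rewrite rootE !hornerE all_r // subrr.
pose S := \sum_(x : 'F_p) Fp x ^+ e; rewrite -/S.
have : (Fp u ^+ e - 1) * S = 0.
  apply/eqP; rewrite mulrBl mul1r subr_eq0; apply/eqP.
  rewrite [RHS](reindex_inj (mulfI u0)) mulr_sumr; apply: eq_bigr => x _.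
  by rewrite (Fp_embedM charkp) exprMn.
move/eqP; rewrite mulf_eq0 => /orP [|/eqP //].
rewrite subr_eq0 -Fp_embedX => /eqP ue1; case/eqP: ue.
by apply: Fp_embed_inj; rewrite ue1; symmetry; apply: (Fp_embed_nat charkp 1).
Qed.

End Equivariance.

(** * Sampling at the points of the prime field *)

Section Sampling.
Variables (k : closedFieldType) (p : nat).
Hypothesis charkp : p \in [pchar k].
Implicit Types (z w : k * k) (g h : {'GL_2(p)}) (v : 'F_p * 'F_p).
Local Notation Fp := (@Fp_embed k p).
Local Notation V n := (V_repr charkp n).

Definition pt v : k * k := (Fp v.1, Fp v.2).

Definition act_Fp g v : 'F_p * 'F_p :=
  (g 0 0 * v.1 + g 1 0 * v.2, g 0 1 * v.1 + g 1 1 * v.2).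

Lemma pt_act g v : pt (act_Fp g v) = act_pt g (pt v).
Proof. by rewrite /pt /act_pt /act_Fp /= !(Fp_embedD charkp) !(Fp_embedM charkp). Qed.

Lemma GL2_mulE g h (i j : 'I_2) :
  ((g * h)%g : {'GL_2(p)}) i j = g i 0 * h 0 j + g i 1 * h 1 j.
Proof.
have l1 : lift 0 0 = 1 :> 'I_2 by apply: val_inj.
by rewrite GL_ME -mulmxE mxE !big_ord_recl big_ord0 addr0 l1.
Qed.

Lemma act_FpM g h v : act_Fp h (act_Fp g v) = act_Fp (g * h)%g v.
Proof. by rewrite /act_Fp !GL2_mulE /=; congr pair; ring. Qed.

Lemma act_Fp1 v : act_Fp 1%g v = v.
Proof.
case: v => a b; rewrite /act_Fp /= -idmxE !mxE /=.
by rewrite !mul1r !mul0r addr0 add0r.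
Qed.

Lemma act_Fp_inj g : injective (act_Fp g).
Proof. by apply: (can_inj (g := act_Fp g^-1%g)) => v; rewrite act_FpM mulgV act_Fp1. Qed.

(** The coefficients of the form [area z _ ^+ n.-1], by the binomial theorem. *)
Definition area_form n z : 'cV[k]_n :=
  \col_(l < n) (z.1 ^+ l * (- z.2) ^+ (n.-1 - l) *+ 'C(n.-1, l)).

Lemma ev_area_form n z w :
  (0 < n)%N -> ev n w *m area_form n z = (area z w ^+ n.-1)%:M.
Proof.
case: n => // n _; rewrite [LHS]mx11_scalar; congr (_%:M).
rewrite mxE /area addrC -mulNr exprDn; apply: eq_bigr => l _.
by rewrite !mxE mulrnAr !exprMn; congr (_ *+ _); rewrite /=; ring.
Qed.

Lemma V_area_form n g z : (0 < n)%N -> g \in SL2 p ->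
  V_mx k n g *m area_form n (act_pt g z) = area_form n z.
Proof.
move=> n0 gG; apply: ev_inj => w.
by rewrite mulmxA ev_V ev_area_form // area_act // ev_area_form.
Qed.

(** The map [f |-> \sum_v f(v) * area v _ ^+ n.-1], over the points [v] of the
    plane over the prime field. The special linear group permutes these points
    and preserves the area, so the map is equivariant, whatever the degrees;
    it is the source of all maps onto simple modules below. *)
Definition sample N n : 'M[k]_(n, N) :=
  \sum_v area_form n (pt v) *m ev N (pt v).

Lemma hom_sample N n : (0 < n)%N -> is_hom (M := V N) (N := V n) (sample N n).
Proof.
move=> n0 g gG; rewrite mulmx_suml mulmx_sumr [RHS](reindex_inj (@act_Fp_inj g)).
apply: eq_bigr => v _; rewrite pt_act mulmxA.
by rewrite V_area_form // -mulmxA ev_V.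
Qed.

Definition power_sum e : k := \sum_(x : 'F_p) Fp x ^+ e.

Lemma power_sum_eq0 e : (0 < e < 2 * p.-1)%N -> e != p.-1 -> power_sum e = 0.
Proof.
move=> /andP [e0 lte] ne; rewrite /power_sum sum_Fp_expr //.
case: ifP => // /andP [_ /dvdnP [q eq]]; case/eqP: ne.
rewrite eq in e0 lte *; rewrite ltn_mul2r in lte.
by case/andP: lte => _; case: q e0 {eq} => [|[|q]] //; rewrite mul1n.
Qed.

Lemma power_sum0 : power_sum 0 = 0.
Proof. by rewrite /power_sum sum_Fp_expr. Qed.

Lemma power_sum_pred m : (0 < m)%N -> power_sum (m * p.-1) = -1.
Proof.
move=> m0; have p1 := prime_gt1 (pcharf_prime charkp).
by rewrite /power_sum sum_Fp_expr // dvdn_mull // muln_gt0 m0 -subn1 subn_gt0 p1.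
Qed.

(** The sum over the plane factors into power sums over the prime field. *)
Lemma sampleE N n (l : 'I_n) (j : 'I_N) : sample N n l j =
  (-1) ^+ (n.-1 - l) * 'C(n.-1, l)%:R *
    (power_sum (l + (N.-1 - j)) * power_sum (n.-1 - l + j)).
Proof.
rewrite summxE /power_sum big_distrlr /= pair_bigA /= mulr_sumr.
apply: eq_bigr => v _; rewrite mxE big_ord1 !mxE /=.
by rewrite -mulr_natr !exprD (exprNn (Fp v.2)); ring.
Qed.

Lemma sample_coef_neq0 n (l : 'I_n) : (n <= p)%N ->
  (-1) ^+ (n.-1 - l) * 'C(n.-1, l)%:R != 0 :> k.
Proof.
move=> lenp; have p_pr := pcharf_prime charkp.
have n0 : (0 < n)%N by apply: leq_ltn_trans (ltn_ord l).
have ln : (l <= n.-1)%N by rewrite -ltnS prednK.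
rewrite mulf_neq0 ?signr_eq0 // -(dvdn_pcharf charkp).
have : ~~ (p %| n.-1`!)%N.
  have : (n.-1 < p)%N by rewrite prednK.
  elim: (n.-1) => [|m IH] ltm; first by rewrite dvdn1 gtn_eqF ?prime_gt1.
  by rewrite factS Euclid_dvdM // negb_or gtnNdvd //= IH // ltnW.
apply: contra => dv; rewrite -(bin_fact ln).
exact: dvdn_mulr.
Qed.

(** The two exponents in [sampleE] add up to [2 * p.-1], so that only the terms
    with both equal to [p.-1] survive: each row has a single nonzero entry, in
    column [l + (p - n)]. *)
Lemma sample_free n : (0 < n <= p)%N -> row_free (sample (2 * p - n) n).
Proof.
move=> /andP [n0 lenp]; have p1 := prime_gt1 (pcharf_prime charkp).
pose c (l : 'I_n) := (-1) ^+ (n.-1 - l) * 'C(n.-1, l)%:R : k.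
apply/row_freeP.
exists (\matrix_(j, l) ((j == (l + (p - n))%N :> nat)%:R / c l)).
apply/matrixP => l' l; rewrite mxE [RHS]mxE.
have ltl : (l + (p - n) < 2 * p - n)%N by have := ltn_ord l; lia.
rewrite (bigD1 (Ordinal ltl)) //= big1 => [|j nj]; last first.
  rewrite [X in _ * X]mxE; case: eqP => [e|]; last by rewrite mul0r mulr0.
  by case/eqP: nj; apply: val_inj.
rewrite addr0 sampleE [X in _ * X]mxE /= eqxx mul1r.
have [->|nl] := eqVneq l' l.
  have -> : (l + ((2 * p - n).-1 - (l + (p - n))) = 1 * p.-1)%N by have := ltn_ord l; lia.
  have -> : (n.-1 - l + (l + (p - n)) = 1 * p.-1)%N by have := ltn_ord l; lia.
  by rewrite power_sum_pred // mulrNN mulr1 mulr1 divff // sample_coef_neq0.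
have nl' : (l' != l :> nat) by [].
set a := (l' + _)%N; have [a0|a0] := posnP a.
  by rewrite a0 power_sum0 mul0r mulr0 mul0r.
rewrite /a in a0 *; set b := (n.-1 - l' + _)%N; have [b0|b0] := posnP b.
  by rewrite b0 power_sum0 !mulr0 mul0r.
rewrite /b in b0 *; rewrite power_sum_eq0 ?mul0r ?mulr0 ?mul0r //.
  by rewrite a0 /=; have := ltn_ord l; have := ltn_ord l'; lia.
by have := ltn_ord l; have := ltn_ord l'; lia.
Qed.

(** In degree [2 * p.-1] the maps onto [V p] and onto [V 1] are jointly onto: the
    section [R] of the first is annihilated by the second. *)
Lemma sample_steinberg :
  exists2 R : 'M_(2 * p - 1, p), sample (2 * p - 1) p *m R = 1%:M
    & exists u : 'cV_(2 * p - 1),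
        sample (2 * p - 1) 1 *m R = 0 /\ sample (2 * p - 1) 1 *m u != 0.
Proof.
have p1 := prime_gt1 (pcharf_prime charkp).
pose c (l : 'I_p) := (-1) ^+ (p.-1 - l) * 'C(p.-1, l)%:R : k.
(* The column of index [p.-1] has nonzero entries in both the first and the last
   row; the section avoids it, reaching the last row through the last column. *)
pose m (l : nat) := if (l < p.-1)%N then l else 2 * p.-1.
have ltm l : (m l < 2 * p - 1)%N by rewrite /m; case: ifP => ?; lia.
pose R : 'M[k]_(2 * p - 1, p) := \matrix_(j, l) ((j == m l :> nat)%:R / c l).
have mulR n (X : 'M[k]_(n, 2 * p - 1)) i l : (X *m R) i l = X i (Ordinal (ltm l)) / c l.
  rewrite mxE (bigD1 (Ordinal (ltm l))) //= big1 => [|j nj]; last first.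
    rewrite [X in _ * X]mxE; case: eqP => [e|]; last by rewrite mul0r mulr0.
    by case/eqP: nj; apply: val_inj.
  by rewrite addr0 [X in _ * X]mxE /= eqxx mul1r.
exists R; first apply/matrixP => l' l.
  rewrite mulR sampleE /= [RHS]mxE.
  have [->|nl] := eqVneq l' l.
    have -> : power_sum (l + ((2 * p - 1).-1 - m l)) = -1.
      rewrite /m; case: ifP => ltl.
        by rewrite (_ : (_ + _)%N = (2 * p.-1)%N) ?power_sum_pred //; lia.
      rewrite (_ : (_ + _)%N = (1 * p.-1)%N) ?power_sum_pred //.
      by have := ltn_ord l; lia.
    have -> : power_sum (p.-1 - l + m l) = -1.
      rewrite /m; case: ifP => ltl.
        by rewrite (_ : (_ + _)%N = (1 * p.-1)%N) ?power_sum_pred //; lia.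
      rewrite (_ : (_ + _)%N = (2 * p.-1)%N) ?power_sum_pred //.
      by have := ltn_ord l; lia.
    by rewrite mulrNN mulr1 mulr1 divff // sample_coef_neq0.
  rewrite /m; have nl' : (l' != l :> nat) by [].
  have sum0 e : (e < p.-1)%N -> power_sum e = 0.
    move=> lte; have [->|e0] := posnP e; first exact: power_sum0.
    by apply: power_sum_eq0; lia.
  have [ltl|lel] := ltnP l p.-1.
    have [lt|le] := ltnP l' l.
      by rewrite power_sum_eq0 ?mul0r ?mulr0 ?mul0r //; lia.
    rewrite [power_sum (p.-1 - _ + _)]sum0 ?mulr0 ?mul0r //.
    by have := ltn_ord l'; lia.
  rewrite sum0 ?mul0r ?mulr0 ?mul0r //.
  by have := ltn_ord l; have := ltn_ord l'; lia.
have ltu : (p.-1 < 2 * p - 1)%N by lia.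
exists (delta_mx (Ordinal ltu) 0); split.
  apply/matrixP => i l; rewrite mulR [RHS]mxE sampleE (ord1 i) /= /m.
  have [ltl|lel] := ltnP l p.-1.
    have sum0 : power_sum l = 0.
      have [->|e0] := posnP l; first exact: power_sum0.
      by apply: power_sum_eq0; lia.
    by rewrite [power_sum (0 + l)]sum0 !mulr0 mul0r.
  have -> : (0 + ((2 * p - 1).-1 - 2 * p.-1))%N = 0%N by lia.
  by rewrite power_sum0 mul0r mulr0 mul0r.
apply/eqP => /matrixP /(_ 0 0); rewrite -colE !mxE sampleE /= => /eqP.
have -> : (0 + ((2 * p - 1).-1 - p.-1) = 1 * p.-1)%N by lia.
have -> : (0 + p.-1 = 1 * p.-1)%N by lia.
by rewrite power_sum_pred // mulrNN !mulr1 expr0 oner_eq0.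
Qed.

Lemma ord2E (i : 'I_2) : (i == 0) || (i == 1).
Proof. by case: i => [[|[|]]]. Qed.

(** Meaningful for invertible [M]; used for [M] of determinant 1. *)
Definition sl2_of (M : 'M['F_p]_2) : {'GL_2(p)} := insubd (1%g : {'GL_2(p)}) M.

Lemma sl2_ofE M : \det M = 1 -> GLval (sl2_of M) = M.
Proof.
move=> d1; apply: (insubdK (1%g : {'GL_2(p)})).
have uM : M \in unitmx by rewrite unitmxE d1 unitr1.
exact: uM.
Qed.

Lemma sl2_of_in M : \det M = 1 -> sl2_of M \in SL2 p.
Proof. by move=> d1; rewrite inE sl2_ofE // d1. Qed.

(** Its row action fixes the point [(0, 1)], where functionals are evaluated. *)
Definition unip_mx (t : 'F_p) : 'M['F_p]_2 :=
  \matrix_(i, j) (if i == j then 1 else if i == 0 then t else 0).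

Lemma det_unip_mx t : \det (unip_mx t) = 1.
Proof. by rewrite det_mx22 !mxE /= mulr1 mulr0 subr0. Qed.

Definition unip t : {'GL_2(p)} := sl2_of (unip_mx t).

Lemma unipE t i j : unip t i j = if i == j then 1 else if i == 0 then t else 0.
Proof. by rewrite /unip sl2_ofE ?det_unip_mx // mxE. Qed.

Lemma unip_in t : unip t \in SL2 p.
Proof. by rewrite sl2_of_in ?det_unip_mx. Qed.

Lemma unip_inj : injective unip.
Proof. by move=> s t /(congr1 (fun g : {'GL_2(p)} => g 0 1)); rewrite !unipE. Qed.

Lemma unipD s t : unip (s + t) = (unip s * unip t)%g.
Proof.
apply: val_inj; apply/matrixP => i j.
transitivity (((unip s * unip t)%g : {'GL_2(p)}) i j); last by [].
rewrite [LHS]unipE GL2_mulE !unipE.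
case/orP: (ord2E i) => /eqP ->; case/orP: (ord2E j) => /eqP -> /=; ring.
Qed.

Lemma unip0 : unip 0 = 1%g.
Proof. by apply: (mulgI (unip 0)); rewrite -unipD addr0 mulg1. Qed.

Definition unipotent : {set {'GL_2(p)}} := [set unip t | t : 'F_p].

Lemma unipotent_group_set : group_set unipotent.
Proof.
apply/group_setP; split=> [|_ _ /imsetP [s _ ->] /imsetP [t _ ->]].
  by rewrite -unip0 imset_f.
by rewrite -unipD imset_f.
Qed.

Canonical unipotent_group := Group unipotent_group_set.

Lemma unipotent_sub : unipotent \subset SL2 p.
Proof. by apply/subsetP => _ /imsetP [t _ ->]; apply: unip_in. Qed.

Lemma card_unipotent : #|unipotent| = p.
Proof.
by rewrite card_imset ?card_Fp ?(pcharf_prime charkp) //; apply: unip_inj.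
Qed.

Lemma sum_unipotent (W : nmodType) (E : {'GL_2(p)} -> W) :
  \sum_(u in unipotent) E u = \sum_t E (unip t).
Proof. by rewrite big_imset //= => s t _ _; apply: unip_inj. Qed.

(** The square of [p] does not divide the order of the general linear group. *)
Lemma unipotent_index : #|SL2 p : unipotent|%g%:R != 0 :> k.
Proof.
have p_pr := pcharf_prime charkp.
rewrite -(dvdn_pcharf charkp); apply/negP => dv.
have : (p * p %| #|'GL_2['F_p]%g|)%N.
  apply: dvdn_trans (cardSg (subsetT (SL2 p))).
  by rewrite -(Lagrange unipotent_sub) card_unipotent dvdn_mul.
rewrite card_GL_2 card_Fp // -mulnA dvdn_pmul2l ?prime_gt0 //.
have p1 := prime_gt1 p_pr.
rewrite Euclid_dvdM // Euclid_dvdX //= andbT => /orP [].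
  by rewrite gtnNdvd //; lia.
by rewrite -addn1 dvdn_addr // dvdn1 gtn_eqF.
Qed.

End Sampling.

(** * The Steinberg module and the dimensions of projective covers *)

Section Cosets.
Variables (k : fieldType) (gT : finGroupType) (G U : {group gT}).
Hypothesis sUG : U \subset G.

Lemma sum_rcosets (W : nmodType) (E : gT -> W) :
  \sum_(g in G) E g =
  \sum_(C in rcosets U G) \sum_(u in U) E (u * repr C)%g.
Proof.
rewrite (set_partition_big _ (rcosets_partition sUG)); apply: eq_bigr => C.
case/rcosetsP => x _ ->; set y := repr _.
have -> : (U :* x = rcoset U y)%g by rewrite rcosetE rcoset_repr.
by rewrite /rcoset big_imset //= => z t _ _; apply: mulIg.
Qed.

Lemma repr_rcosets C : C \in rcosets U G -> repr C \in G.
Proof.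
case/rcosetsP => x xG ->; have := mem_repr_rcoset U x.
by apply: subsetP; rewrite mul_subG // sub1set.
Qed.

(** The classical reduction of projectivity to a Sylow subgroup: the trace from
    [U] to [G] of the identity is the index of [U]. *)
Lemma higman_of_subgroup (M : representation k G) (th : 'M_(rdegree M)) :
    #|G : U|%g%:R != 0 :> k -> \sum_(u in U) M u *m th *m M u^-1%g = 1%:M ->
  higman M.
Proof.
move=> nz th1; exists ((#|G : U|%g%:R)^-1 *: th).
have {}th1 : \sum_(u in U) M u^-1%g *m th *m M u = 1%:M.
  rewrite -th1 [RHS](reindex_inj invg_inj); apply: eq_big => [u|u _]; first by rewrite groupV.
  by rewrite invgK.
have -> : \sum_(g in G) M g *m ((#|G : U|%g%:R)^-1 *: th) *m M g^-1%g =
    (#|G : U|%g%:R)^-1 *: \sum_(g in G) M g^-1%g *m th *m M g.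
  rewrite (reindex_inj invg_inj) scaler_sumr; apply: eq_big => [u|u _]; first by rewrite groupV.
  by rewrite invgK -scalemxAr -scalemxAl.
rewrite sum_rcosets (eq_bigr (fun _ => 1%:M)) => [|C CG].
  by rewrite sumr_const -scaler_nat scalerA mulVf // scale1r.
have xG := repr_rcosets CG; set x := repr C in xG *.
transitivity (M x^-1%g *m (\sum_(u in U) M u^-1%g *m th *m M u) *m M x).
  rewrite mulmx_sumr mulmx_suml; apply: eq_bigr => u uU; have uG := subsetP sUG u uU.
  by rewrite invMg !repr_mxM ?groupV // !mulmxA.
by rewrite th1 mulmx1 -repr_mxM ?groupV // mulVg repr_mx1.
Qed.

Lemma subgroup_of_higman (M : representation k G) : higman M ->
  exists th : 'M_(rdegree M), \sum_(u in U) M u *m th *m M u^-1%g = 1%:M.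
Proof.
move=> [th th1]; exists (\sum_(C in rcosets U G) M (repr C) *m th *m M (repr C)^-1%g).
rewrite -th1 sum_rcosets [RHS]exchange_big /=; apply: eq_bigr => u uU.
have uG := subsetP sUG u uU.
rewrite mulmx_sumr mulmx_suml; apply: eq_bigr => C CG.
have xG := repr_rcosets CG.
by rewrite invMg !repr_mxM ?groupV // !mulmxA.
Qed.

End Cosets.

Section Dimensions.
Variables (k : closedFieldType) (p : nat).
Hypothesis charkp : p \in [pchar k].
Local Notation Fp := (@Fp_embed k p).
Local Notation V n := (V_repr charkp n).

Local Notation unip := (@unip p).

Lemma act_unip t (z : k * k) : act_pt (unip t) z = (z.1, Fp t * z.1 + z.2).
Proof.
rewrite /act_pt !unipE /=.
by rewrite (Fp_embed_nat charkp 1) (Fp_embed_nat charkp 0) !mul1r mul0r addr0.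
Qed.

Lemma unipV t : (unip t)^-1%g = unip (- t).
Proof. by apply/eqP; rewrite eq_invg_mul -unipD subrr unip0. Qed.

(** A polynomial of degree below [p] is determined by its values on the prime
    field. *)
Lemma ev_Fp_eq0 q (X : 'M[k]_(p, q)) :
  (forall s, ev p (1, Fp s) *m X = 0) -> X = 0.
Proof.
move=> X0; apply/matrixP => i l; rewrite [RHS]mxE.
have p_pr := pcharf_prime charkp.
pose f : {poly k} := \poly_(i < p) (if insub i is Some j then X j l else 0).
have fE y : f.[y] = (ev p (1, y) *m X) 0 l.
  rewrite horner_poly mxE; apply: eq_bigr => j _.
  by rewrite valK mulrC mxE expr1n mul1r.
suff f0 : f = 0.
  by have := coef_poly p (fun i => if insub i is Some j then X j l else 0) i;
    rewrite -/f f0 coef0 ltn_ord valK.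
apply/eqP; apply: contraT => nf0.
have sz : size (map Fp (enum 'F_p)) = p by rewrite size_map -cardE card_Fp.
have : (p < size f)%N.
  rewrite -{1}sz; apply: max_poly_roots => //.
    by apply/allP => _ /mapP [s _ ->]; rewrite rootE fE X0 mxE.
  by rewrite map_inj_uniq ?enum_uniq //; apply: Fp_embed_inj.
by rewrite ltnNge size_poly.
Qed.

(** Restriction to the points [(1, s)] identifies [V p] with the functions on the
    prime field, on which the unipotent group acts by translations: a free
    module of rank one. *)
Lemma higman_steinberg : higman (V p).
Proof.
have p_pr := pcharf_prime charkp.
have p1 := prime_gt1 p_pr.
have lt0 : (0 < p)%N by apply: prime_gt0.
have ltp : (p.-1 < p)%N by rewrite prednK.
(* The indicator function of [0]: the form [X ^+ p.-1 - Y ^+ p.-1]. *)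
pose c : 'cV[k]_p := delta_mx (Ordinal lt0) 0 - delta_mx (Ordinal ltp) 0.
have evc y : ev p (1, Fp y) *m c = (y == 0)%:R%:M.
  rewrite mulmxBr -!colE [LHS]mx11_scalar !mxE /= !expr1n !mul1r expr0.
  congr (_%:M); case: (eqVneq y 0) => [->|y0].
    by rewrite (Fp_embed_nat charkp 0) expr0n gtn_eqF ?subr0 // -subn1 subn_gt0.
  have F0 : Fp y != 0 by rewrite Fp_embed_eq0.
  apply/eqP; rewrite subr_eq0 eq_sym; apply/eqP/(mulfI F0).
  rewrite mulr1 -exprS prednK // -(Fp_embedX charkp).
  by rewrite -{2}(expf_card y) card_Fp.
apply: (@higman_of_subgroup _ _ _ (unipotent_group p) _ (V p) (c *m ev p (1, Fp 0))).
- exact: unipotent_sub.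
- exact: unipotent_index.
rewrite sum_unipotent.
apply/eqP; rewrite -subr_eq0; apply/eqP/ev_Fp_eq0 => s.
rewrite mulmxBr mulmx1 mulmx_sumr (bigD1 (- s)) //= big1 => [|t ts].
  rewrite unipV opprK addr0 !mulmxA ev_V act_unip /= mulr1 -(Fp_embedD charkp) addNr evc eqxx.
  by rewrite mul1mx ev_V act_unip /= mulr1 -(Fp_embedD charkp) addr0 subrr.
rewrite !mulmxA ev_V act_unip /= mulr1 -(Fp_embedD charkp) evc.
by rewrite addr_eq0 (negPf ts) mul_scalar_mx scale0r mul0mx.
Qed.

Lemma sum_Fp_nat (W : nmodType) (E : 'F_p -> W) :
  \sum_(t : 'F_p) E t = \sum_(i < p) E i%:R.
Proof.
rewrite -(big_mkord xpredT (fun i => E i%:R)).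
rewrite -[X in _ = \sum_(0 <= i < X) _](Fp_cast (pcharf_prime charkp)) big_mkord.
by apply: eq_bigr => i _; rewrite natr_Zp.
Qed.

(** In characteristic [p] the polynomials [('X - 1) ^+ p] and ['X ^+ p - 1]
    coincide; divide both by ['X - 1]. *)
Lemma exp_pred_char n (u : 'M[k]_n) : (u - 1) ^+ p.-1 = \sum_(i < p) u ^+ i.
Proof.
case: n u => [|n] u; first by rewrite [LHS]flatmx0 [RHS]flatmx0.
have p_pr := pcharf_prime charkp.
have poly_id : ('X - 1 : {poly k}) ^+ p.-1 = \sum_(i < p) 'X ^+ i.
  have X1 : ('X - 1 : {poly k}) != 0 by rewrite -[1]/(1%:P) polyXsubC_eq0.
  apply: (mulfI X1); rewrite -subrX1 -exprS prednK ?prime_gt0 //.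
  have charP : p \in [pchar {poly k}] by rewrite pchar_poly.
  by rewrite -!(pFrobenius_autE charP) pFrobenius_autB_comm ?pFrobenius_aut1 //; apply: mulrC.
have := congr1 (horner_mx u) poly_id.
rewrite rmorphXn rmorphB /= horner_mx_X rmorph1 => ->.
by rewrite rmorph_sum; apply: eq_bigr => i _; rewrite rmorphXn /= horner_mx_X.
Qed.

(** A projective module is free over the unipotent group, so every invariant
    functional accounts for [p] dimensions. With [x = u - 1] for a generator [u],
    invariant functionals are killed by [x] and, by Higman's criterion, are
    norms, that is multiples of [x ^+ p.-1]; so each of the [p] successive
    multiplications by [x] lowers the rank by at least [d]. *)
Lemma dim_ge_invariants (M : representation k (SL2_group p)) d
    (R : 'M[k]_(d, rdegree M)) :
    higman M -> row_free R -> (forall t, R *m M (unip t) = R) ->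
  (p * d <= rdegree M)%N.
Proof.
move=> /(subgroup_of_higman (U := unipotent_group p) (unipotent_sub p)) [th].
rewrite sum_unipotent => th1 fR RU.
have p_pr := pcharf_prime charkp.
pose u : 'M[k]_(rdegree M) := M (unip 1).
have uX (i : nat) : u ^+ i = M (unip i%:R).
  elim: i => [|i IH]; first by rewrite unip0 repr_mx1.
  by rewrite exprS IH -natr1 addrC unipD repr_mxM ?unip_in.
pose x := u - 1.
have RN : R = R *m th *m x ^+ p.-1.
  rewrite exp_pred_char -[LHS]mulmx1 -th1 !mulmx_sumr.
  rewrite (reindex_inj oppr_inj) /= sum_Fp_nat; apply: eq_bigr => i _.
  by rewrite unipV opprK uX !mulmxA RU.
have Rx : R *m x = 0 by rewrite mulmxBr mulmx1 RU subrr.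
have rank_x l : (l <= p)%N -> (d * l <= \rank (x ^+ (p - l)))%N.
  elim: l => [|l IH] lp; first by rewrite muln0.
  have pE : (p - l = (p - l.+1).+1)%N by lia.
  have lE : p.-1 = (l + (p - l.+1))%N by lia.
  move: (p - l.+1)%N pE lE => e pE lE.
  have := mxrank_mul_ker (x ^+ e) x.
  have -> : x ^+ e *m x = x ^+ (p - l) by rewrite pE exprSr.
  move=> <-; rewrite mulnS addnC leq_add ?IH ?(ltnW lp) //.
  rewrite -{1}(eqP fR); apply: mxrankS; rewrite sub_capmx; apply/andP; split.
    by rewrite RN lE exprD -mulmxE mulmxA submxMl.
  exact/sub_kermxP.
by have := rank_x p (leqnn p); rewrite subnn expr0 mxrank1 mulnC.
Qed.

Lemma ev01_unip n t : ev n (0, 1) *m V n (unip t) = ev n (0, 1).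
Proof. by rewrite /= ev_V act_unip /= mulr0 add0r. Qed.

Lemma ev01_neq0 n : (0 < n)%N -> ev n (0, 1) != 0 :> 'rV[k]_n.
Proof.
case: n => // n _; apply/eqP => /rowP /(_ ord_max); rewrite !mxE /= subnn expr0 mul1r expr1n.
by move/eqP; rewrite oner_eq0.
Qed.

(** The cover [P] of [V n] carries the invariant functional [s], evaluation at
    [(0, 1)] on [V n]. For [n != 1] a lift [i] of [e : P -> V n] along the sampling
    map from [V (2 * p - n)] gives a second one, [t], again evaluation at
    [(0, 1)]. Sampling expresses [s] as the sum over [v] of [v.1 ^+ n.-1] times a
    translate of [t] that evaluates at [v]. Were [t] a multiple of [s], evaluation
    at [(0, 1)] on [V n] would be a combination of evaluations at the points [v]
    of [V n] with these coefficients, which is false on the form [Y ^+ n.-1]: the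
    combination there is a square of the power sum of exponent [n.-1], which
    vanishes for [0 < n.-1 < p.-1]. *)
Lemma dim_projective_cover n (P : representation k (SL2_group p)) :
    (0 < n < p)%N -> projective_cover P (V n) ->
  (p * (if n == 1 then 1 else 2) <= rdegree P)%N.
Proof.
move=> /andP [n0 ltnp] [prP [e [[he fe] _]]].
have hP := projective_higman prP.
have p_pr := pcharf_prime charkp; have p1 := prime_gt1 p_pr.
pose s : 'rV_(rdegree P) := ev n (0, 1) *m e.
have sU t : s *m P (unip t) = s.
  by rewrite -mulmxA he ?unip_in // mulmxA ev01_unip.
have cancel_e q (X Y : 'M_(q, n)) : X *m e = Y *m e -> X = Y by apply: row_free_inj.
have s0 : s != 0.
  apply/eqP => s0; have /eqP := ev01_neq0 n0; apply.
  by apply: cancel_e; rewrite mul0mx.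
case: eqP => n1.
  by apply: (@dim_ge_invariants P 1 s) => //; rewrite /row_free rank_rV s0.
have lenp : (n <= p)%N by apply: ltnW.
have epi : is_epi (M := V (2 * p - n)) (N := V n) (sample k p (2 * p - n) n).
  by split; [apply: hom_sample | apply: sample_free; rewrite ?n0].
have [i hi ie] := prP _ _ _ _ epi he.
pose t : 'rV_(rdegree P) := ev (2 * p - n) (0, 1) *m i.
have tU a : t *m P (unip a) = t.
  by rewrite -mulmxA hi ?unip_in // mulmxA ev01_unip.
have ntc c : t <> c *: s.
  move=> tc.
  pose r : 'rV[k]_n :=
    \sum_(v : 'F_p * 'F_p) (c * Fp v.1 ^+ n.-1) *: ev n (pt k v).
  have sr : ev n (0, 1) = r.
    have sE : s = ev n (0, 1) *m sample k p (2 * p - n) n *m i.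
      by rewrite -mulmxA ie.
    apply: cancel_e; rewrite -[LHS]/s sE /sample mulmx_sumr mulmx_suml [RHS]mulmx_suml.
    apply: eq_bigr => v _.
    rewrite mulmxA ev_area_form // mul_scalar_mx -!scalemxAl.
    have -> : area (pt k v) (0, 1) = Fp v.1 by rewrite /area /= mulr1 mulr0 subr0.
    rewrite [c * _]mulrC -scalerA; have [v0|v0] := eqVneq v.1 0.
      rewrite v0 (Fp_embed_nat charkp 0) expr0n gtn_eqF ?scale0r //.
      by rewrite -subn1 subn_gt0 ltn_neqAle eq_sym n0 andbT; apply/eqP.
    congr (_ *: _).
    (* A matrix of determinant 1 with bottom row [v], taking [(0, 1)] to [v]. *)
    pose M : 'M['F_p]_2 := \matrix_(i, j)
      (if i == 0 then if j == 0 then 0 else - v.1^-1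
       else if j == 0 then v.1 else v.2).
    have dM : \det M = 1.
      by rewrite det_mx22 !mxE /= mul0r sub0r mulNr opprK mulVf.
    pose g := sl2_of M.
    have gG : g \in SL2_group p by apply: sl2_of_in.
    have gv : act_pt g (0, 1) = pt k v.
      by rewrite /act_pt /g !sl2_ofE // !mxE /= !mulr0 !mulr1 !add0r.
    have evg N : ev N (pt k v) = ev N (0, 1) *m V N g by rewrite /= ev_V gv.
    by rewrite !evg -!mulmxA -hi // -he // !mulmxA -/t tc -scalemxAl -/s.
  have /rowP := sr; have ltn : (n.-1 < n)%N by rewrite prednK.
  move/(_ (Ordinal ltn)); rewrite /r summxE [LHS]mxE /= subnn expr0 mul1r expr1n.
  have -> : \sum_(v : 'F_p * 'F_p)
      ((c * Fp v.1 ^+ n.-1) *: ev n (pt k v)) 0 (Ordinal ltn) =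
      c * (power_sum k p n.-1 * power_sum k p n.-1).
    rewrite /power_sum big_distrlr /= pair_bigA mulr_sumr; apply: eq_bigr => v _.
    by rewrite !mxE /= subnn expr0 mul1r mulrA.
  move/eqP; rewrite power_sum_eq0 ?mulr0 ?oner_eq0 //; lia.
apply: (@dim_ge_invariants P (1 + 1) (col_mx s t)) => //.
  apply/inj_row_free => v.
  rewrite -[v]hsubmxK [lsubmx v]mx11_scalar [rsubmx v]mx11_scalar.
  rewrite (mul_row_col _ _ s t) !mul_scalar_mx.
  set a := lsubmx _ _ _; set b := rsubmx _ _ _ => ab0.
  have b0 : b = 0.
    apply/eqP; apply: contraT => b0; case: (ntc (- (b^-1 * a))).
    apply: (scalerI b0); rewrite scalerA mulrN mulrA divff // mul1r scaleNr.
    by apply/eqP; rewrite -addr_eq0 addrC ab0.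
  move: ab0; rewrite b0 scale0r addr0 => /eqP; rewrite scaler_eq0 (negPf s0) orbF => /eqP ->.
  by rewrite !raddf0 row_mx0.
by move=> a; rewrite mul_col_mx sU tU.
Qed.

End Dimensions.

(** * Tensor products with the Steinberg module *)

Section DirectSums.
Variables (k : fieldType) (gT : finGroupType) (G : {group gT}).
Implicit Types A B C : representation k G.

Lemma rsim_dadd A A' B B' : mx_rsim A A' -> mx_rsim B B' ->
  mx_rsim (dadd_grepr A B) (dadd_grepr A' B').
Proof.
move=> [X dimA fX hX] [Y dimB fY hY].
exists (block_mx X 0 0 Y); first by rewrite /= dimA dimB.
  have /row_freeP [X' XX'] := fX; have /row_freeP [Y' YY'] := fY.
  apply/row_freeP; exists (block_mx X' 0 0 Y').
  by rewrite mulmx_block !mulmx0 !mul0mx !addr0 !add0r XX' YY' -scalar_mx_block.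
move=> g gG; rewrite /= !mulmx_block !mulmx0 !mul0mx !addr0 !add0r.
by rewrite hX // hY.
Qed.

Lemma rsim_daddC A B : mx_rsim (dadd_grepr A B) (dadd_grepr B A).
Proof.
exists (block_mx 0 1%:M 1%:M 0); first by rewrite /= addnC.
  apply/row_freeP; exists (block_mx 0 1%:M 1%:M 0).
  by rewrite mulmx_block !mulmx0 !mul0mx !mulmx1 !addr0 !add0r -scalar_mx_block.
by move=> g gG; rewrite /= !mulmx_block !mulmx0 !mul0mx !mulmx1 !mul1mx !addr0 !add0r.
Qed.

Lemma rsim_daddA A B C :
  mx_rsim (dadd_grepr A (dadd_grepr B C)) (dadd_grepr (dadd_grepr A B) C).
Proof.
pose X : 'M[k]_(rdegree A + (rdegree B + rdegree C),
                (rdegree A + rdegree B) + rdegree C) :=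
  block_mx (row_mx 1%:M 0) 0 (col_mx (row_mx 0 1%:M) 0) (col_mx 0 1%:M).
pose Y : 'M[k]_((rdegree A + rdegree B) + rdegree C,
                rdegree A + (rdegree B + rdegree C)) :=
  block_mx (col_mx 1%:M 0) (col_mx 0 (row_mx 1%:M 0)) 0 (row_mx 0 1%:M).
exists X; first by rewrite /= addnA.
  apply/row_freeP; exists Y.
  rewrite /X /Y mulmx_block !mul_row_col !mul_col_row !mul_mx_row !mul_col_mx.
  rewrite ?mulmx0 ?mul0mx ?mulmx1 ?mul1mx ?addr0 ?add0r.
  rewrite !mul_row_col ?mulmx0 ?mul0mx ?mulmx1 ?mul1mx ?addr0 ?add0r.
  rewrite !row_mx0 !col_mx0 !addr0 [X in _ + X]block_mxEv add_col_mx row_mx0.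
  rewrite addr0 add0r -block_mxEv.
  by rewrite -scalar_mx_block -scalar_mx_block.
move=> g gG; rewrite /= /X !mulmx_block.
  rewrite ?mulmx0 ?mul0mx ?mulmx1 ?mul1mx ?addr0 ?add0r.
  rewrite !mul_mx_row !mul_row_block !mul_block_col !mul_col_mx .
  rewrite ?mulmx0 ?mul0mx ?mulmx1 ?mul1mx ?addr0 ?add0r.
by rewrite mul_mx_row mul_row_block !mulmx0 !mul0mx mulmx1 mul1mx !add0r.
Qed.

Lemma rsim_dadd0 A : mx_rsim (dadd_grepr grepr0 A) A.
Proof.
exists (col_mx 0 1%:M : 'M_(0 + rdegree A, rdegree A)) => //.
  apply/row_freeP; exists (row_mx 0 1%:M).
  rewrite mul_col_row !mulmx1 !mul0mx [RHS](@scalar_mx_block _ 0 (rdegree A)) mulmx0.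
  by congr block_mx; rewrite [RHS]flatmx0.
move=> g gG; rewrite /= mul_block_col mul_col_mx !mulmx0 !mul0mx ?mulmx1 ?mul1mx ?add0r.
by [].

Qed.

End DirectSums.

Section SteinbergTensor.
Variables (k : closedFieldType) (p : nat).
Hypothesis charkp : p \in [pchar k].
Local Notation V n := (V_repr charkp n).

(** Polarization followed by multiplication by the area embeds [V p (x) V j] in
    [V p (x) V j.+2], with [p = (j + c).+1]. The source is injective, so it has a
    complement [A], of dimension [2 * p]; the maps that kill the multiples of the
    area lose nothing when restricted to [A]. *)
Lemma steinberg_tensor_split j c : (j + c).+1 = p -> (0 < c)%N ->
  exists (A : representation k (SL2_group p))
         (i : 'M_((j + c).+1 * j.+2, rdegree A))
         (q : 'M_(rdegree A, (j + c).+1 * j.+2)),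
   [/\ higman A, rdegree A = (p * 2)%N,
       is_hom (M := A) (N := tens (V (j + c).+1) (V j.+2)) i,
       mx_rsim (tens (V (j + c).+1) (V j.+2))
               (dadd_grepr (tens (V (j + c).+1) (V j)) A)
     & forall r (t : 'M_(r, (j + c).+1 * j.+2)),
         t *m area_mx k (j + c) j.+1 = 0 -> t *m i *m q = t].
Proof.
move=> pE c0.
have p_pr := pcharf_prime charkp.
have hV : higman (V (j + c).+1) by rewrite pE; apply: higman_steinberg.
pose f : 'M[k]_((j + c).+1 * j.+2, (j + c).+1 * j) :=
  area_mx k (j + c) j.+1 *m polar_mx k (j + c) j.
have hf : is_hom (M := tens (V (j + c).+1) (V j)) (N := tens (V (j + c).+1) (V j.+2)) f.
  exact: (is_hom_mul (hom_polar charkp (j + c) j) (hom_area charkp (j + c) j.+1)).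
have ff : row_full f.
  apply: inj_row_full => q X; rewrite -mulmxA => /area_mx_inj fX.
  have [] // := @polar_area_pow_inj k c j q X 0; last by rewrite fX mulmx0 addr0.
  by move=> l /andP [l0 lm]; rewrite -(dvdn_pcharf charkp) gtnNdvd // -pE ltnS.
have [r hr rf] := higman_retraction (higman_tens (V j) hV) hf ff.
have [A [i [q [hi sum1 dimE rs hA]]]] := complement hf hr rf.
exists A, i, q; split=> //.
- by apply: hA; apply: higman_tens.
- by move: dimE => /=; rewrite pE; nia.
by move=> d t ta; rewrite -[RHS]mulmx1 -sum1 mulmxDr /f !mulmxA ta !mul0mx add0r.
Qed.

(** As restriction to the diagonal comes first, this map kills the multiples of
    the area. *)
Definition sample_mul a b n : 'M[k]_(n, a * b) :=
  sample k p (a + b).-1 n *m diag_mul_mx k a b.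

Lemma hom_sample_mul a b n : (0 < n)%N ->
  is_hom (M := tens (V a) (V b)) (N := V n) (sample_mul a b n).
Proof.
by move=> n0; apply: (is_hom_mul (hom_diag_mul charkp a b) (hom_sample charkp _ n0)).
Qed.

Lemma sample_mul_area a b n : sample_mul a.+1 b.+1 n *m area_mx k a b = 0.
Proof. by rewrite -mulmxA diag_mul_area mulmx0. Qed.

Lemma sample_mul_free a b n : (0 < n <= p)%N -> (a + b.+1 = 2 * p - n)%N ->
  row_free (sample_mul a.+1 b.+1 n).
Proof.
move=> np abE; rewrite /row_free mxrankMfree ?diag_mul_free //.
by have := sample_free charkp np; rewrite -abE.
Qed.

(** The complement maps onto [V c], hence onto its cover [P]; as the dimension
    of [P] is at least [2 * p], that of the complement, the two agree. *)
Lemma steinberg_tensor_step j c (P : representation k (SL2_group p)) :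
    (j + c).+1 = p -> (1 < c)%N -> projective_cover P (V c) ->
  mx_rsim (tens (V (j + c).+1) (V j.+2))
          (dadd_grepr (tens (V (j + c).+1) (V j)) P).
Proof.
move=> pE c1 cP.
have [A [i [q [hA dimA hi rs iq]]]] := steinberg_tensor_split pE (ltnW c1).
have cp : (0 < c < p)%N by lia.
pose t := sample_mul (j + c).+1 j.+2 c.
have ht : is_hom (M := tens (V (j + c).+1) (V j.+2)) (N := V c) t.
  by apply: hom_sample_mul; apply: ltnW.
have ft : row_free t by apply: sample_mul_free; lia.
have epi : is_epi (M := A) (N := V c) (t *m i).
  split; first exact: is_hom_mul hi ht.
  have [s ts] := row_freeP ft; apply/row_freeP; exists (q *m s).
  by rewrite mulmxA iq // sample_mul_area.
have dimP := dim_projective_cover cp cP.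
apply: mx_rsim_trans rs _; apply: rsim_dadd; first exact: mx_rsim_refl.
apply: (rsim_projective_cover hA epi cP).
by move: dimP; rewrite dimA gtn_eqF.
Qed.

(** For [c = 1] the complement maps onto [V p (+) V 1]. The projective module
    [V p] splits off, and what remains has dimension [p] and maps onto [V 1]. *)
Lemma steinberg_tensor_last j (P : representation k (SL2_group p)) :
    j.+2 = p -> projective_cover P (V 1) ->
  mx_rsim (tens (V j.+2) (V j.+2))
          (dadd_grepr (tens (V j.+2) (V j)) (dadd_grepr (V j.+2) P)).
Proof.
move=> pE cP.
have pE' : (j + 1).+1 = p by rewrite addn1.
have := steinberg_tensor_split pE' isT; rewrite addn1 => -[A [i [q [hA dimA hi rs iq]]]].
have p0 : (0 < p)%N by rewrite -pE.
pose t := sample_mul j.+2 j.+2 p; pose t1 := sample_mul j.+2 j.+2 1.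
have ht : is_hom (M := tens (V j.+2) (V j.+2)) (N := V p) t by apply: hom_sample_mul.
have ht1 : is_hom (M := tens (V j.+2) (V j.+2)) (N := V 1) t1 by apply: hom_sample_mul.
have dimE : (2 * p - 1 = (j.+2 + j.+2).-1)%N by lia.
have := sample_steinberg charkp; rewrite dimE => -[R tR [u [uR u1]]].
have [D dD] := row_freeP (diag_mul_free k j.+1 j.+1).
have tDR : t *m (D *m R) = 1%:M by rewrite -mulmxA (mulmxA _ D) dD mul1mx.
have ta : t *m area_mx k j.+1 j.+1 = 0 by apply: sample_mul_area.
have t1a : t1 *m area_mx k j.+1 j.+1 = 0 by apply: sample_mul_area.
have hV : higman (V p) := higman_steinberg charkp.
have hti : is_hom (M := A) (N := V p) (t *m i) := is_hom_mul hi ht.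
have epi : is_epi (M := A) (N := V p) (t *m i).
  split=> //; apply/row_freeP; exists (q *m (D *m R)).
  by rewrite mulmxA iq // tDR.
have h1 : is_hom (M := V p) (N := V p) 1%:M by move=> g gG; rewrite mul1mx mulmx1.
have [f hf tf] := higman_projective hV epi h1.
have [K [i' [q' [hi' sum1 dimK rsK hK]]]] := complement hf hti tf.
have epi1 : is_epi (M := K) (N := V 1) (t1 *m i *m i').
  split; first exact: (is_hom_mul hi' (is_hom_mul hi ht1)).
  rewrite /row_free rank_rV eqb1.
  pose x := D *m (u - R *m (sample k p (j.+2 + j.+2).-1 p *m u)).
  have tx : t *m x = 0.
    rewrite /x -mulmxA (mulmxA _ D) dD mul1mx mulmxBr (mulmxA _ R) tR mul1mx.
    exact: subrr.
  have t1x : t1 *m x != 0.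
    by rewrite /x -mulmxA (mulmxA _ D) dD mul1mx mulmxBr (mulmxA _ R) uR mul0mx subr0.
  clearbody x t t1; apply: contraNneq t1x => z.
  rewrite -(iq _ _ t1a) -(mulmx1 (t1 *m i)) -sum1 mulmxDr mulmxDl (mulmxA _ i') z !mul0mx addr0.
  have tiq : t *m (i *m (q *m x)) = 0 by rewrite !mulmxA iq // tx.
  by rewrite -!mulmxA tiq !mulmx0.
apply: mx_rsim_trans rs _; apply: rsim_dadd; first exact: mx_rsim_refl.
apply: mx_rsim_trans rsK _.
have -> : V p = V j.+2 by rewrite pE.
apply: rsim_dadd; first exact: mx_rsim_refl.
apply: (rsim_projective_cover (hK hA) epi1 cP).
have p1 : (0 < 1 < p)%N by lia.
have := dim_projective_cover p1 cP; rewrite eqxx muln1; apply: leq_trans.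
by move: dimK => /=; rewrite dimA; lia.
Qed.

Lemma steinberg_tensor1 (P : representation k (SL2_group p)) :
  projective_cover P (V p) -> mx_rsim (tens (V p) (V 1)) P.
Proof.
move=> cP.
have p0 : (0 < p)%N by apply: prime_gt0 (pcharf_prime charkp).
have ht : is_hom (M := tens (V p.-1.+1) (V 1)) (N := V p) (sample_mul p.-1.+1 1 p).
  exact: hom_sample_mul.
have ft : row_free (sample_mul p.-1.+1 1 p) by apply: sample_mul_free; lia.
have hQ : higman (tens (V p.-1.+1) (V 1)).
  by apply: higman_tens; rewrite prednK //; apply: higman_steinberg.
have dimP : (rdegree (tens (V p.-1.+1) (V 1)) <= rdegree P)%N.
  case: cP => _ [e [[_ fe] _]]; rewrite /= muln1 prednK //.
  by have := rank_leq_col e; rewrite (eqP fe).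
have := rsim_projective_cover hQ (conj ht ft) cP dimP.
by rewrite prednK.
Qed.

End SteinbergTensor.

(** * The decomposition *)

Section BigSums.
Variables (k : fieldType) (gT : finGroupType) (G : {group gT}).
Implicit Types A B C : representation k G.

Lemma rsim_daddCA A B C :
  mx_rsim (dadd_grepr A (dadd_grepr B C)) (dadd_grepr B (dadd_grepr A C)).
Proof.
apply: mx_rsim_trans (rsim_daddA A B C) _.
apply: mx_rsim_trans (mx_rsim_sym (rsim_daddA B A C)).
exact: rsim_dadd (rsim_daddC A B) (mx_rsim_refl C).
Qed.

Lemma rsim_dadd0r A : mx_rsim (dadd_grepr A grepr0) A.
Proof. exact: mx_rsim_trans (rsim_daddC A grepr0) (rsim_dadd0 A). Qed.

(** Direct sums of representations are commutative and associative only up to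
    similarity, so [bigD1] does not apply to them. *)
Lemma rsim_bigD1 (I : eqType) (r : seq I) (Q : pred I) (F : I -> representation k G) x :
    uniq r -> x \in r -> Q x ->
  mx_rsim (\big[dadd_grepr/grepr0]_(i <- r | Q i) F i)
    (dadd_grepr (F x) (\big[dadd_grepr/grepr0]_(i <- r | Q i && (i != x)) F i)).
Proof.
move=> ur xr Qx; elim: r ur xr => // y r IH /andP [yr ur].
rewrite inE !big_cons; case: eqVneq yr => [<- yr _|nxy yr xr].
  rewrite Qx; have -> : \big[dadd_grepr/grepr0]_(i <- r | Q i && (i != x)) F i =
      \big[dadd_grepr/grepr0]_(i <- r | Q i) F i.
    rewrite -big_filter -[RHS]big_filter; congr bigop.
    apply: eq_in_filter => i ir; case: eqP => [ix|]; last by rewrite andbT.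
    by rewrite -ix ir in yr.
  exact: mx_rsim_refl.
rewrite andbT; case: (Q y); last exact: IH.
have FyIH := rsim_dadd (mx_rsim_refl (F y)) (IH ur xr).
exact: mx_rsim_trans FyIH (rsim_daddCA _ _ _).
Qed.

Lemma rsim_big_nat_add1 p (Q Q' : pred nat) (F : nat -> representation k G) x :
    (1 <= x <= p)%N ->
    (forall i, (1 <= i <= p)%N -> Q i = (i == x) || Q' i) -> ~~ Q' x ->
  mx_rsim (\big[dadd_grepr/grepr0]_(1 <= i < p.+1 | Q i) F i)
    (dadd_grepr (F x) (\big[dadd_grepr/grepr0]_(1 <= i < p.+1 | Q' i) F i)).
Proof.
move=> xp QE Q'x.
have Qx : Q x by rewrite QE // eqxx.
have xr : x \in index_iota 1 p.+1 by rewrite mem_index_iota ltnS.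
rewrite [X in dadd_grepr _ X]
  (_ : _ = \big[dadd_grepr/grepr0]_(1 <= i < p.+1 | Q i && (i != x)) F i).
  exact: rsim_bigD1 (iota_uniq _ _) xr Qx.
apply: congr_big_nat => // i; rewrite ltnS => ip; rewrite QE //.
by case: eqVneq => [->|] /=; rewrite ?andbT ?andbF //; apply: negbTE.
Qed.

End BigSums.

(** The symmetric form of the membership condition shows how it depends on
    [n - m] and [n + m], one of which is constant in each recursion. *)
Lemma angleE n m i : (m <= n)%N ->
  (i \in angle n m) = [&& (n - m < i)%N, (i < n + m)%N & odd (i + (n + m))].
Proof.
move=> lemn; apply/mapP/and3P => [[j]|[lti ltm od]].
  by rewrite mem_iota => /andP [_ ltj] ->; split; lia.
exists ((i - (n - m + 1))./2); first by rewrite mem_iota; lia.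
lia.
Qed.

Section ClebschGordan.
Variables (p : nat) (k : closedFieldType).
Hypothesis charkp : p \in [pchar k].
Variable P : nat -> representation k (SL2_group p).
Hypothesis coverP : forall i : nat, (1 <= i <= p)%N ->
  projective_cover (P i) (V_repr charkp i).
Local Notation V n := (V_repr charkp n).
Local Notation simple_part n m :=
  (\big[dadd_grepr/grepr0]_(1 <= i < p.+1 |
    (i \in angle n m) && (2 * p - i \notin angle n m)%N) V i).
Local Notation projective_part n m :=
  (\big[dadd_grepr/grepr0]_(1 <= i < p.+1 |
    (i \in angle n m) && (2 * p - i \in angle n m)%N) P i).

Lemma rsim_degree0 (A B : representation k (SL2_group p)) :
  rdegree A = 0%N -> rdegree B = 0%N -> mx_rsim A B.
Proof.
case: A B => [a A] [b B] /= a0 b0; move: A B; rewrite a0 b0 => A B.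
exists 1%:M => //; first by rewrite row_free_unit unitmx1.
by move=> g _; rewrite [LHS]flatmx0 [RHS]flatmx0.
Qed.

Lemma projective_part_step j : (j.+2 <= p)%N ->
  mx_rsim (projective_part p j.+2)
    (dadd_grepr (P (p - j.+1)) (projective_part p j)).
Proof.
move=> jp; apply: rsim_big_nat_add1; first by lia.
  move=> i ip; rewrite !angleE; lia.
rewrite !angleE; lia.
Qed.

Lemma projective_part0 n : projective_part n 0 = grepr0.
Proof. by rewrite big_pred0. Qed.

Lemma steinberg_tensor j : (j < p)%N ->
  mx_rsim (tens (V p) (V j)) (projective_part p j).
Proof.
have p0 : (0 < p)%N by apply: prime_gt0 (pcharf_prime charkp).
elim/ltn_ind: j => -[_ _|[_ p1|j IH jp]].
- by rewrite projective_part0; apply: rsim_degree0 => //=; rewrite muln0.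
- have cP : projective_cover (P p) (V p) by apply: coverP; rewrite p0 leqnn.
  apply: mx_rsim_trans (steinberg_tensor1 cP) _; apply: mx_rsim_sym.
  apply: mx_rsim_trans (rsim_dadd0r (P p)).
  have : mx_rsim (projective_part p 1) (dadd_grepr (P p) (projective_part p 0)).
    apply: rsim_big_nat_add1; first by rewrite p0 leqnn.
      by move=> i ip; rewrite !angleE //; lia.
    by rewrite !angleE //; lia.
  by rewrite projective_part0.
have [c pE] : exists c, (j + c).+1 = p by exists (p - j.+1)%N; lia.
have c1 : (1 < c)%N by lia.
have cP : projective_cover (P c) (V c) by apply: coverP; lia.
have := steinberg_tensor_step pE c1 cP; rewrite pE => st.
apply: mx_rsim_trans st _; apply: mx_rsim_trans (rsim_daddC _ _) _.
have jp' : (j < p)%N by lia.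
have jj : (j < j.+2)%N by lia.
apply: mx_rsim_trans (rsim_dadd (mx_rsim_refl _) (IH j jj jp')) _.
have -> : P c = P (p - j.+1) by congr P; lia.
by apply/mx_rsim_sym/projective_part_step; lia.
Qed.

Lemma steinberg_tensor_square :
  mx_rsim (tens (V p) (V p)) (dadd_grepr (projective_part p p) (V p)).
Proof.
have p1 : (1 < p)%N by apply: prime_gt1 (pcharf_prime charkp).
have [j pE] : exists j, j.+2 = p by exists p.-2; lia.
have cP : projective_cover (P 1) (V 1) by apply: coverP; lia.
have := steinberg_tensor_last pE cP; rewrite pE => st.
apply: mx_rsim_trans st _.
have jp : (j < p)%N by lia.
apply: mx_rsim_trans (rsim_dadd (steinberg_tensor jp) (mx_rsim_refl _)) _.
apply: mx_rsim_trans (rsim_daddCA _ _ _) _; apply: mx_rsim_trans (rsim_daddC _ _) _.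
apply: rsim_dadd; last exact: mx_rsim_refl.
apply: mx_rsim_trans (rsim_daddC _ _) _.
have := projective_part_step (j := j); rewrite pE leqnn => /(_ isT) st2.
have -> : P 1 = P (p - j.+1) by congr P; lia.
exact: mx_rsim_sym.
Qed.

Lemma simple_part_steinberg m : (m <= p)%N -> simple_part p m = grepr0.
Proof.
move=> mp; rewrite big_nat_cond big_pred0 // => i.
rewrite !angleE //; lia.
Qed.

(** Induction on [p - n]: each step splits off the smallest index [n - m + 1],
    whose mirror image [2 * p - (n - m + 1)] is too large to occur. *)
Lemma clebsch_gordan n m : (m <= n)%N -> (n <= p)%N ->
  mx_rsim (tens (V n) (V m))
    (dadd_grepr (dadd_grepr (simple_part n m) (projective_part n m))
      (if (n == m) && (m == p) then V p else grepr0)).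
Proof.
have [d dE] : exists d, (p - n)%N = d by exists (p - n)%N.
elim: d n m dE => [|d IH] n m dE lemn lenp.
  have -> : n = p by lia.
  have lemp : (m <= p)%N by lia.
  rewrite simple_part_steinberg //; apply: mx_rsim_sym.
  apply: mx_rsim_trans (rsim_dadd (rsim_dadd0 _) (mx_rsim_refl _)) _.
  rewrite eq_sym andbb; case: eqVneq => [->|nmp].
    exact: mx_rsim_sym steinberg_tensor_square.
  apply: mx_rsim_trans (rsim_dadd0r _) _.
  by apply/mx_rsim_sym/steinberg_tensor; rewrite ltn_neqAle nmp.
have ltnp : (n < p)%N by lia.
case: m lemn => [_|m ltmn].
  have -> : simple_part n 0 = grepr0 by rewrite big_pred0.
  rewrite projective_part0 (_ : (n == 0) && (0 == p) = false)%N; last by lia.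
  by apply: rsim_degree0 => //=; rewrite muln0.
have [c nE] : exists c, n = (m + c)%N by exists (n - m)%N; lia.
have step : mx_rsim (tens (V n) (V m.+1)) (dadd_grepr (V c) (tens (V n.+1) (V m))).
  by rewrite nE; apply: clebsch_gordan_step; lia.
apply: mx_rsim_trans step _.
have dE' : (p - n.+1 = d)%N by lia.
apply: mx_rsim_trans (rsim_dadd (mx_rsim_refl _) (IH n.+1 m dE' _ ltnp)) _;
  first by lia.
rewrite (_ : (n.+1 == m) && (m == p) = false); last by lia.
rewrite (_ : (n == m.+1) && (m.+1 == p) = false); last by lia.
apply: mx_rsim_trans (rsim_daddA _ _ _) _; apply: rsim_dadd; last exact: mx_rsim_refl.
apply: mx_rsim_trans (rsim_daddA _ _ _) _.
have -> : projective_part n.+1 m = projective_part n m.+1.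
  apply: congr_big_nat => // i ip; rewrite !angleE //; lia.
apply: rsim_dadd; last exact: mx_rsim_refl.
apply/mx_rsim_sym/rsim_big_nat_add1; first by lia.
  by move=> i ip; rewrite !angleE //; lia.
by rewrite !angleE; lia.
Qed.

End ClebschGordan.

Local Close Scope ring_scope.

Theorem theorem3p7 (p : nat) (k : closedFieldType)
    (p_prime : prime p) (charkp : p \in [pchar k]%R)
    (P : nat -> representation k (SL2_group p))
    (coverP : forall i : nat, 1 <= i <= p ->
      projective_cover (P i) (V_repr charkp i))
    (n m : nat) (le1m : 1 <= m) (lemn : m <= n) (lenp : n <= p) :
  mx_rsim
    (prod_repr (V_repr charkp n) (V_repr charkp m))
    (dadd_grepr
      (dadd_grepr
        (\big[dadd_grepr/grepr0]_(1 <= i < p.+1 |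
            (i \in angle n m) && (2 * p - i \notin angle n m)) V_repr charkp i)
        (\big[dadd_grepr/grepr0]_(1 <= i < p.+1 |
            (i \in angle n m) && (2 * p - i \in angle n m)) P i))
      (if (n == m) && (m == p) then V_repr charkp p else grepr0)).
Proof. exact: (clebsch_gordan coverP lemn lenp). Qed.
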